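(* Let $m\ge2$. Let $X$ and $Y$ be bodies in $\mathbb{R}^m$. Suppose that the complement $Y^c$ satisfies the uniform interior cone condition of aperture angle $\kappa$ and height $\delta$, where $0<\kappa\le\pi$ and $0<\delta\le+\infty$. Let $0<R_0<\operatorname{diam}Y$, and let $\tilde R=\tilde R(-1,\kappa,\delta,\operatorname{diam}Y,R_0)$. Then for any $0<b<1$ there exists $h_0>0$ such that if $0<h<h_0$, then for any $x\in X$ with $\operatorname{dist}(x,X^c)\ge R_0$ and any $y\in\mathbb{R}^m$ with $\operatorname{dist}(y,Y^c)\le b\tilde R$, we have $A_Y(y,h)<A_X(x,h)$.
   Context: A body in $\mathbb{R}^m$ is the closure of a bounded open set. $X^c$ is the complement of $X$ and $B_\rho(x)$ the closed ball of radius $\rho$ centered at $x$. Solid angle function of a body $\Omega$: $A_\Omega(x,h)=h\int_\Omega\left(|x-\xi|^2+h^2\right)^{-(m+1)/2}d\xi$ for $x\in\mathbb{R}^m$, $h>0$. The open cone of vertex $x$, axis direction $v\in S^{m-1}$, aperture angle $\kappa$ and height $\delta$ is $\{x+\rho w: 0<\rho<\delta,\ w\in S^{m-1},\ w\cdot v>\cos(\kappa/2)\}$. An open set $U$ satisfies the uniform interior cone condition of aperture angle $\kappa$ and height $\delta$ if for each $x\in U$ there is an open cone of vertex $x$, aperture angle $\kappa$ and height $\delta$ contained in $U$. Definition of $\tilde R$ (for $\alpha\le0$): let $C_\theta(x;\kappa,\delta)$ be the open cone of vertex $x$, axis direction $\cos\theta\, e_1+\sin\theta\, e_m$, aperture angle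 $\kappa$ and height $\delta$. For $D>0$, $0<R_0<D$ and $R>0$ put $E(R)=\min_{0\le\theta\le(\pi-\kappa)/2}\left(\int_{C_\theta(Re_1;\kappa,\delta)\cap B_D(0)}|\xi|^{\alpha-m}d\xi-\int_{B_D(0)\setminus B_{R_0}(0)}|\xi|^{\alpha-m}d\xi\right).$ There is a unique positive number $\tilde R=\tilde R(\alpha,\kappa,\delta,D,R_0)$ with $E(\tilde R)=0$; moreover $E(R)>0$ for $R<\tilde R$, $E(R)<0$ for $R>\tilde R$, and $\tilde R<R_0$. *)

(* Defs.v *)
From HB Require Import structures.
From mathcomp Require Import all_boot all_order all_algebra.
From mathcomp Require Import all_classical all_reals all_analysis.
Set Implicit Arguments.
Unset Strict Implicit.
Unset Printing Implicit Defensive.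
Import Order.TTheory GRing.Theory Num.Theory.
Import numFieldNormedType.Exports.
Local Open Scope classical_set_scope.
Local Open Scope ring_scope.

(** * Lebesgue measure on ['rV[R]_m] *)

Definition rV_display : measure_display. Proof. exact. Qed.

Section measurable_rV.
Context {R : realType} (n : nat).

(* The product sigma-algebra; for [R] real it is the Borel sigma-algebra. *)
Let coors (i : 'I_n) (x : 'rV[R]_n) : measurableTypeR R := x ord0 i.

Let rV_set0 : g_sigma_preimage coors set0.
Proof. exact: sigma_algebra0. Qed.

Let rV_setC A : g_sigma_preimage coors A -> g_sigma_preimage coors (~` A).
Proof. exact: sigma_algebraC. Qed.

Let rV_bigcup (F : _^nat) : (forall i, g_sigma_preimage coors (F i)) ->
  g_sigma_preimage coors (\bigcup_i (F i)).
Proof. exact: sigma_algebra_bigcup. Qed.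

HB.instance Definition _ := @isMeasurable.Build rV_display
  'rV[R]_n (g_sigma_preimage coors) rV_set0 rV_setC rV_bigcup.

Lemma measurable_coord (i : 'I_n) :
  measurable_fun [set: 'rV[R]_n] (fun x => x ord0 i : measurableTypeR R).
Proof.
move=> _ Y mY; rewrite setTI; apply: sub_sigma_algebra => /=.
rewrite -bigcup_seq/=; exists i => /=; first by rewrite mem_index_enum.
by exists Y => //; rewrite setTI.
Qed.

Lemma measurable_fun_rVP d (T : measurableType d) (f : T -> 'rV[R]_n) :
  measurable_fun [set: T] f <->
  forall i, measurable_fun [set: T] (fun t => f t ord0 i : measurableTypeR R).
Proof.
split=> [mf i|mf].
  by apply: (@measurableT_comp _ _ _ _ _ _ (fun x : 'rV[R]_n => x ord0 i))
    => //; exact: measurable_coord.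
move=> _ A mA; rewrite setTI.
suff : g_sigma_preimage coors `<=` [set B | measurable (f @^-1` B)] by exact.
apply: smallest_sub.
  split=> /=.
  - by rewrite preimage_set0; exact: measurable0.
  - by move=> B mB; rewrite setTD preimage_setC; exact: measurableC.
  - by move=> F mF; rewrite preimage_bigcup; exact: bigcup_measurable.
rewrite -bigcup_seq => B /= [i _ [C mC <-]].
rewrite setTI -comp_preimage.
by have := mf i measurableT C mC; rewrite setTI.
Qed.

End measurable_rV.

Section lebesgue_rV.
Context {R : realType}.

Definition rV_cons (n : nat) (p : measurableTypeR R * 'rV[R]_n) : 'rV[R]_n.+1 :=
  row_mx (const_mx p.1 : 'rV[R]_1) p.2.

Definition rV_uncons (n : nat) (x : 'rV[R]_n.+1) : measurableTypeR R * 'rV[R]_n :=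
  (x ord0 ord0, rsubmx (x : 'rV[R]_(1 + n))).

Lemma rV_consK n : cancel (@rV_cons n) (@rV_uncons n).
Proof.
case=> a x; rewrite /rV_uncons /rV_cons; congr pair; last by rewrite row_mxKr.
have := row_mxEl (const_mx a : 'rV[R]_1) x ord0 ord0.
rewrite [RHS]mxE => /= e; rewrite -[RHS]e; congr (row_mx _ _ _ _).
exact: val_inj.
Qed.

Lemma measurable_rV_cons n : measurable_fun setT (@rV_cons n).
Proof.
apply/measurable_fun_rVP => i.
case si : (@fintype.split 1 n i) => [j|j].
  rewrite (_ : (fun _ => _) = fst) ?measurable_fst//.
  by apply/funext => p; rewrite /rV_cons mxE si mxE.
rewrite (_ : (fun _ => _) = (fun x : 'rV[R]_n => x ord0 j) \o snd); last first.
  by apply/funext => p; rewrite /rV_cons mxE si.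
apply: measurableT_comp; last exact: measurable_snd.
exact: measurable_coord.
Qed.

Lemma measurable_rV_uncons n : measurable_fun setT (@rV_uncons n).
Proof.
apply: measurable_fun_pair; first exact: measurable_coord.
apply/measurable_fun_rVP => i.
rewrite (_ : (fun _ => _) =
  fun x : 'rV[R]_n.+1 => x ord0 (rshift 1 i : 'I_n.+1)).
  exact: measurable_coord.
by apply/funext => x; rewrite mxE.
Qed.

Section step.
Context (n : nat) (mu : {sigma_finite_measure set 'rV[R]_n -> \bar R}).
Local Open Scope ereal_scope.

Definition lebesgue_rV_step : set 'rV[R]_n.+1 -> \bar R :=
  pushforward (@lebesgue_measure R \x mu) (@rV_cons n).

Let step0 : lebesgue_rV_step set0 = 0.
Proof. by rewrite /lebesgue_rV_step /pushforward preimage_set0 measure0. Qed.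

Let step_ge0 A : 0 <= lebesgue_rV_step A.
Proof. by rewrite /lebesgue_rV_step /pushforward measure_ge0. Qed.

Let mpreimage (A : set 'rV[R]_n.+1) :
  measurable A -> measurable (@rV_cons n @^-1` A).
Proof. by move=> mA; rewrite -[X in measurable X]setTI; exact: measurable_rV_cons. Qed.

Let step_sigma_additive : semi_sigma_additive lebesgue_rV_step.
Proof.
move=> F mF tF mUF; rewrite /lebesgue_rV_step /pushforward preimage_bigcup.
apply: measure_semi_sigma_additive.
- by move=> k; exact: mpreimage.
- apply/trivIsetP => /= i j _ _ ij; rewrite -preimage_setI.
  by move/trivIsetP : tF => /(_ _ _ _ _ ij) ->//; rewrite preimage_set0.
- by rewrite -preimage_bigcup; exact: mpreimage.
Qed.

HB.instance Definition _ := isMeasure.Build _ _ _ lebesgue_rV_step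
  step0 step_ge0 step_sigma_additive.

Let step_sigma_finite : sigma_finite setT lebesgue_rV_step.
Proof.
have /sigma_finiteP[F [FT ndF Foo]] := sigma_finiteT (@lebesgue_measure R).
have /sigma_finiteP[G [GT ndG Goo]] := sigma_finiteT mu.
exists (fun k => @rV_uncons n @^-1` (F k `*` G k)).
  rewrite -preimage_bigcup (_ : \bigcup_k _ = setT) ?preimage_setT//.
  apply/seteqP; split=> // -[x y] _.
  have [k _ Fx] : (\bigcup_k F k) x by rewrite -FT.
  have [l _ Gy] : (\bigcup_k G k) y by rewrite -GT.
  exists (maxn k l) => //; split=> /=.
    by move: x Fx; exact/subsetPset/ndF/leq_maxl.
  by move: y Gy; exact/subsetPset/ndG/leq_maxr.
move=> k; have [mF Fk] := Foo k; have [mG Gk] := Goo k.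
have mFG : measurable (F k `*` G k) by exact: measurableX.
split.
  by rewrite -[X in measurable X]setTI; exact: measurable_rV_uncons.
rewrite /lebesgue_rV_step /pushforward -comp_preimage.
rewrite (_ : _ \o _ = id) ?preimage_id; last exact/funext/rV_consK.
by rewrite product_measure1E// lte_mul_pinfty// ge0_fin_numE.
Qed.

HB.instance Definition _ := Measure_isSigmaFinite.Build _ _ _ lebesgue_rV_step
  step_sigma_finite.

End step.

(* The [m]-fold product of the one-dimensional Lebesgue measure, carried over to
   row vectors by [rV_cons]. *)
Fixpoint lebesgue_rV (m : nat) : {sigma_finite_measure set 'rV[R]_m -> \bar R} :=
  match m with
  | 0 => @dirac _ 'rV[R]_0 0 R
  | n.+1 => lebesgue_rV_step (lebesgue_rV n)
  end.

End lebesgue_rV.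


(** * Euclidean geometry *)

(* The library norm on ['rV[R]_m] is the sup norm. It has the same open and
   bounded sets as the Euclidean norm, so [open], [closure] and [bounded_set]
   keep their usual meaning; lengths, distances and diameters do not, and are
   taken with respect to [enorm]. *)
Section euclidean.
Context {R : realType} {m : nat}.
Implicit Types (x y u v w : 'rV[R]_m) (A X U : set 'rV[R]_m).

Definition dotrV u v : R := \sum_(i < m) u ord0 i * v ord0 i.

Definition enorm x : R := Num.sqrt (dotrV x x).

Definition cball x (r : R) : set 'rV[R]_m := [set y | enorm (y - x) <= r].

Definition euclid_dist x A : R := inf [set enorm (x - z) | z in A].

Definition euclid_diam A : R := sup [set enorm (x - y) | x in A & y in A].

Definition body X : Prop :=
  exists U, [/\ open U, bounded_set U & X = closure U].

Definition open_cone x v (kappa : R) (delta : \bar R) : set 'rV[R]_m :=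
  [set y | exists rho w, [/\ 0 < rho, (rho%:E < delta)%E, enorm w = 1,
     cos (kappa / 2) < dotrV w v & y = x + rho *: w]].

(* The axis direction may depend on the vertex. *)
Definition uniform_interior_cone U (kappa : R) (delta : \bar R) : Prop :=
  open U /\ forall x, U x ->
    exists2 v, enorm v = 1 & open_cone x v kappa delta `<=` U.

Definition solid_angle (Omega : set 'rV[R]_m) x (h : R) : R :=
  h * (\int[lebesgue_rV m]_(xi in Omega)
         ((enorm (x - xi) ^+ 2 + h ^+ 2) `^ (- (m%:R + 1) / 2)))%R.

End euclidean.

(** * The radius [Rtilde] *)

Section Rtilde.
Context {R : realType} (m : nat).

(* The [k]-th vector of the standard basis, counting from 0. *)
Definition basis_rV (k : nat) : 'rV[R]_m := \row_(j < m) ((j : nat) == k)%:R.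

Context (alpha kappa : R) (delta : \bar R) (D R0 : R).

Definition axis_cone (theta r : R) : set 'rV[R]_m :=
  open_cone (r *: basis_rV 0)
    (cos theta *: basis_rV 0 + sin theta *: basis_rV m.-1) kappa delta.

Definition riesz_integral (A : set 'rV[R]_m) : \bar R :=
  (\int[lebesgue_rV m]_(xi in A) (enorm xi `^ (alpha - m%:R))%:E)%E.

(* The infimum is a minimum, by continuity in [theta]. *)
Definition cone_excess (r : R) : \bar R :=
  ereal_inf [set (riesz_integral (axis_cone theta r `&` cball 0 D)
                  - riesz_integral (cball 0 D `\` cball 0 R0))%E
            | theta in `[0, (pi - kappa) / 2]].

(* The unique positive zero of [cone_excess]. *)
Definition Rtilde : R := xget 0 [set r : R | 0 < r /\ cone_excess r = 0%E].

End Rtilde.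

(* Main.v *)
From HB Require Import structures.
Require Import Defs.
From mathcomp Require Import all_boot all_order all_algebra.
From mathcomp Require Import all_classical all_reals all_analysis.
From mathcomp Require Import measurable_realfun ring lra.
Set Implicit Arguments.
Unset Strict Implicit.
Unset Printing Implicit Defensive.
Import Order.TTheory GRing.Theory Num.Theory.
Import numFieldNormedType.Exports.
Local Open Scope classical_set_scope.
Local Open Scope ring_scope.

(** Writing [k h t] for the kernel [(t^2 + h^2)^(-(m+1)/2)], the claim is, after
division by [h], that the integral over [Y] of [k h] centred at [y] is smaller
than the integral over [X] of [k h] centred at [x]. The latter is at least
the integral over a ball of radius [R0], because [X] contains the closed ball
of radius [R0] about [x] ([cball_sub_of_dist]).

Suppose [y] lies in [Y], and let [D] be the diameter of [Y]. Then [Y] is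
contained in the ball of radius [D] about [y], minus a cone of [~` Y] whose
vertex [z] is at distance at most [r] from [y]. Hence it suffices that this
cone, cut by the ball of radius [D], outweighs the annulus between the radii
[R0] and [D] ([angle_integral_lt]). Three facts give this.

- Among all cones whose vertex is within [r] of the centre, the one with
  vertex at distance exactly [r] and axis pointing radially outwards has the
  least integral, for every radially nonincreasing kernel
  ([integral_cone_min]). Turning the axis to the radial direction is a
  polarization: the reflection exchanging the two axes moves the part of the
  radial cone that is lost towards the centre. So the minimum in the
  definition of the excess is attained at the angle 0, and only the function
  [cone_riesz] of the distance [r] matters.
- Scaling by [b <= 1] about the centre gives
  [cone_riesz r <= b * cone_riesz (b * r)] ([cone_riesz_scale]). Since
  [cone_riesz] is at least the integral [K > 0] of the Riesz kernel over the
  annulus at [Rtilde], it is strictly larger than [K] at each smaller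
  radius; it also exceeds every constant at small radii. The second fact
  takes over when the excess has no positive zero, and [Rtilde] is 0 by
  convention ([Rtilde_lt_cone_riesz]).
- On the extremal cone all points are at distance at least [r], where [k h]
  is the Riesz kernel [t^(-1-m)] up to a factor that tends to 1 as [h] tends
  to 0; on the annulus the Riesz kernel bounds [k h] from above. So the
  strict inequality at [h = 0] persists for all small [h], uniformly in the
  position of the cone ([cone_angle_kernel_gt]).

If [y] lies outside [Y], the cone has its vertex at [y] itself. The points of
[Y] farther than [D] from [y] contribute at most a constant, and the cone
integral exceeds any constant when [h] is small.

The invariance of Lebesgue measure under reflections and its behaviour under
dilations come from the uniqueness argument for Haar measure
([integral_rV_additive]). *)

(** * Monotonicity of the integral, and translations of the line *)

Section le_integral.
Context d (T : measurableType d) (R : realType) (mu : {measure set T -> \bar R}).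
Local Open Scope ereal_scope.

(** The integral of a nonnegative function is a supremum over the simple
functions below it, so monotonicity needs no measurability. This spares a proof
that a body is a measurable set. *)
Lemma ge0_integral_le_nonmeas (D E : set T) (f g : T -> \bar R) :
  (forall x, D x -> 0 <= f x) -> (forall x, E x -> 0 <= g x) ->
  (forall x, D x -> E x /\ f x <= g x) ->
  \int[mu]_(x in D) f x <= \int[mu]_(x in E) g x.
Proof.
move=> f0 g0 fg; rewrite !ge0_integralE//.
apply: le_ereal_sup => _ [k /= kf <-]; exists k => // x.
apply: le_trans (kf x) _; rewrite /patch; case: ifPn => [|_].
  by rewrite inE => /fg[/mem_set -> ].
by case: ifPn => //; rewrite inE => /g0.
Qed.

End le_integral.

Section lebesgue1.
Context {R : realType}.
Local Open Scope ereal_scope.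

Let shift (c : R) : measurableTypeR R -> measurableTypeR R := fun x => (x + c)%R.

Let measurable_shift (c : R) : measurable_fun setT (shift c).
Proof. exact: measurable_funD. Qed.

Lemma lebesgue_measure_shift (c : R) (A : set (measurableTypeR R)) :
  measurable A ->
  pushforward (@lebesgue_measure R) (shift c) A = lebesgue_measure A.
Proof.
move=> mA.
pose shift_mixin := isMeasurableFun.Build _ _ _ _ _ (measurable_shift c).
pose shift_mfun : {mfun _ >-> _} := HB.pack (shift c) shift_mixin.
pose nu := pushforward (@lebesgue_measure R) shift_mfun.
apply/esym/(@lebesgue_measure_unique _ nu) => //= _ [[a b]] _ <-.
rewrite /nu /pushforward /=.
rewrite (_ : _ @^-1` _ = `](a - c)%R, (b - c)%R]%classic); last first.
  by apply/seteqP; split => x /=; rewrite !in_itv/= ltrBlDr lerBrDr.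
rewrite !lebesgue_measure_itv/= !lte_fin ltrD2r.
by case: ifP => // _; rewrite -!EFinB; congr (_%:E); ring.
Qed.

Lemma integral_lebesgue_shift (c : R) (f : measurableTypeR R -> \bar R) :
  measurable_fun setT f -> (forall x, 0 <= f x) ->
  \int[@lebesgue_measure R]_x f (x + c)%R = \int[@lebesgue_measure R]_x f x.
Proof.
move=> mf f0.
rewrite -[LHS](ge0_integral_pushforward (measurable_shift c) (@lebesgue_measure R) measurableT mf)//.
apply: eq_measure_integral => //= A mA _.
exact: lebesgue_measure_shift.
Qed.

End lebesgue1.

(** * Lebesgue measure on row vectors: translations, additive maps, boxes *)

Section rV_integral.
Context {R : realType}.

Lemma rV_unconsK n : cancel (@rV_uncons R n) (@rV_cons R n).
Proof.
move=> x; rewrite /rV_cons /rV_uncons /=; apply/rowP => i.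
rewrite mxE; case: (@splitP 1 n i) => j ij.
  by rewrite mxE (_ : i = ord0)//; apply/val_inj; rewrite /= ij ord1.
by rewrite mxE; congr (x _ _); exact/val_inj.
Qed.

Definition rV_box n (r : R) : set 'rV[R]_n := [set x | forall i, `|x ord0 i| <= r].
Arguments rV_box : clear implicits.

Lemma rV_consD n (p q : measurableTypeR R * 'rV[R]_n) :
  rV_cons (p.1 + q.1, p.2 + q.2) = rV_cons p + rV_cons q.
Proof.
apply/rowP => i; rewrite /rV_cons !mxE /=.
by case: (@splitP 1 n i) => j _; rewrite !mxE.
Qed.

Lemma measurable_addrV n (c : 'rV[R]_n) :
  measurable_fun [set: 'rV[R]_n] (fun x => x + c).
Proof.
apply/measurable_fun_rVP => i.
rewrite (_ : (fun _ => _) = (fun x : 'rV[R]_n => x ord0 i + c ord0 i)); last first.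
  by apply/funext => x; rewrite mxE.
apply: measurable_funD; [exact: measurable_coord|exact: measurable_cst].
Qed.

Local Open Scope ereal_scope.

(** Tonelli along the first coordinate, by the recursive definition of the measure. *)
Lemma integral_rV_cons n (f : 'rV[R]_n.+1 -> \bar R) :
  measurable_fun setT f -> (forall x, 0 <= f x) ->
  \int[lebesgue_rV n.+1]_x f x =
  \int[@lebesgue_measure R]_a \int[lebesgue_rV n]_y f (rV_cons (a, y)).
Proof.
move=> mf f0.
rewrite -(@fubini_tonelli1 _ _ _ _ _ (@lebesgue_measure R) (lebesgue_rV n)
  (f \o @rV_cons R n))//.
- rewrite -[RHS](ge0_integral_pushforward (@measurable_rV_cons R n)
    ((@lebesgue_measure R) \x (lebesgue_rV n)) measurableT mf)//.
- by apply: (measurableT_comp mf); exact: measurable_rV_cons.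
- by move=> x; exact: f0.
Qed.

Lemma integral_rV_shift n (c : 'rV[R]_n) (f : 'rV[R]_n -> \bar R) :
  measurable_fun setT f -> (forall x, 0 <= f x) ->
  \int[lebesgue_rV n]_x f (x + c)%R = \int[lebesgue_rV n]_x f x.
Proof.
elim: n c f => [|n IH] c f mf f0.
  by apply: eq_integral => x _; congr f; apply/rowP => -[].
have mfs : measurable_fun [set: 'rV[R]_n.+1] (fun x : 'rV[R]_n.+1 => f (x + c)%R).
  by apply: (measurableT_comp mf); exact: measurable_addrV.
have mfc : measurable_fun setT (f \o @rV_cons R n).
  by apply: (measurableT_comp mf); exact: measurable_rV_cons.
have mfa a : measurable_fun [set: 'rV[R]_n] (fun y => f (rV_cons (a, y))).
  apply: (measurableT_comp mfc); exact: pair1_measurable.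
rewrite (integral_rV_cons mfs (fun x => f0 _)) (integral_rV_cons mf f0).
set d := rV_uncons c.
transitivity (\int[@lebesgue_measure R]_a
    \int[lebesgue_rV n]_y f (rV_cons ((a + d.1)%R, y))).
  apply: eq_integral => a _; rewrite -[RHS](IH d.2)//.
  by apply: eq_integral => y _; rewrite -[in LHS](rV_unconsK c) -rV_consD.
apply: (integral_lebesgue_shift d.1
  (f := fun a => \int[lebesgue_rV n]_y f (rV_cons (a, y)))).
  by apply: (@measurable_fun_fubini_tonelli_F _ _ _ _ _ (lebesgue_rV n)
     (f \o @rV_cons R n)) => // x /=.
by move=> a; apply: integral_ge0.
Qed.

(** The uniqueness argument for Haar measure: integrate [f (T x) * 1_B (y - T x)]
over both variables. Translation invariance in [y] gives the left-hand side.
Translating [x] by [S y] turns the integrand into [f (y + T x) * 1_B (- T x)],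
and translation invariance in [y] now gives the right-hand side. Thus [T]
multiplies integrals by a constant that any one set [B] of positive finite
measure determines. *)
Lemma integral_rV_additive n (T S : 'rV[R]_n -> 'rV[R]_n) (B : set 'rV[R]_n)
    (f : 'rV[R]_n -> \bar R) :
  {morph T : x y / (x + y)%R} -> cancel S T ->
  measurable_fun setT T -> measurable B ->
  measurable_fun setT f -> (forall x, 0 <= f x) ->
  \int[lebesgue_rV n]_x f (T x) * lebesgue_rV n B =
  lebesgue_rV n [set x | B (- T x)%R] * \int[lebesgue_rV n]_x f x.
Proof.
move=> TD ST mT mB mf f0.
set mu := lebesgue_rV n.
pose g (x : 'rV[R]_n) : \bar R := (\1_B x)%:E.
have mg : measurable_fun setT g by apply/measurable_EFinP; exact: measurable_indic.
have g0 x : 0 <= g x by rewrite lee_fin.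
have mN : measurable_fun [set: 'rV[R]_n] (fun x => - T x)%R.
  apply/measurable_fun_rVP => i.
  rewrite (_ : (fun _ => _) = (\- (fun x : 'rV[R]_n => T x ord0 i))%R); last first.
    by apply/funext => x; rewrite mxE.
  by apply: measurable_funN; exact: (measurable_fun_rVP T).1.
have mTB : measurable [set x | B (- T x)%R].
  have := mN measurableT _ mB; rewrite setTI; exact.
pose F (p : 'rV[R]_n * 'rV[R]_n) := f (T p.1) * g (p.2 - T p.1)%R.
have mF : measurable_fun setT F.
  apply: emeasurable_funM.
    by apply: (measurableT_comp mf); apply: (measurableT_comp mT).
  apply: (measurableT_comp mg); apply/measurable_fun_rVP => i.
  rewrite (_ : (fun _ => _) = (fun p : 'rV[R]_n * 'rV[R]_n => p.2 ord0 i + (- T p.1)%R ord0 i)%R); last first.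
    by apply/funext => x; rewrite mxE.
  apply: measurable_funD.
    by apply: (measurableT_comp (@measurable_coord _ _ i)).
  apply: (measurableT_comp (f := (fun x : 'rV[R]_n => x ord0 i) \o (fun x => - T x)%R)) => //.
  by apply: measurableT_comp => //; exact: measurable_coord.
have F0 p : 0 <= F p by rewrite mule_ge0.
transitivity (\int[mu]_x \int[mu]_y F (x, y)).
  rewrite muleC -(ge0_integralZl mu measurableT (measurableT_comp mf mT)) => [|x _|]//; last exact: f0.
  apply: eq_integral => x _ /=.
  rewrite /F /= ge0_integralZl//; last first.
    by apply: (measurableT_comp mg); exact: measurable_addrV.
  rewrite (integral_rV_shift _ mg g0) integral_indic// setIT.
  by rewrite muleC.
apply: etrans (@fubini_tonelli _ _ _ _ _ mu mu _ mF F0) _.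
transitivity (\int[mu]_y \int[mu]_x (f (y + T x)%R * g (- T x)%R)).
  apply: eq_integral => y _.
  rewrite -(integral_rV_shift (S y)); last 2 first.
  - by apply: (measurableT_comp mF); exact: pair2_measurable.
  - by move=> x.
  apply: eq_integral => x _; rewrite /F /= TD ST; congr (f _ * g _).
    by rewrite addrC.
  by rewrite opprD addrC subrK.
pose G (p : 'rV[R]_n * 'rV[R]_n) := f (p.1 + T p.2)%R * g (- T p.2)%R.
have mG : measurable_fun setT G.
  apply: emeasurable_funM; last first.
    by apply: (measurableT_comp mg); exact: (measurableT_comp mN).
  apply: (measurableT_comp mf); apply/measurable_fun_rVP => i.
  rewrite (_ : (fun _ => _) = (fun p : 'rV[R]_n * 'rV[R]_n => p.1 ord0 i + (T p.2)%R ord0 i)%R); last first.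
    by apply/funext => x; rewrite mxE.
  apply: measurable_funD.
    by apply: (measurableT_comp (@measurable_coord _ _ i)).
  apply: (measurableT_comp (f := (fun x : 'rV[R]_n => x ord0 i) \o T)) => //.
  by apply: measurableT_comp => //; exact: measurable_coord.
have G0 p : 0 <= G p by rewrite mule_ge0.
apply: etrans (@fubini_tonelli _ _ _ _ _ mu mu _ mG G0) _.
transitivity (\int[mu]_x (\int[mu]_y f y * g (- T x)%R)).
  apply: eq_integral => x _; rewrite /G /=.
  rewrite ge0_integralZr//; last first.
    by apply: (measurableT_comp mf); exact: measurable_addrV.
  by rewrite integral_rV_shift.
rewrite ge0_integralZl//; last 2 first.
- by apply: (measurableT_comp mg mN).
- exact: integral_ge0.
rewrite muleC; congr (_ * _).
rewrite (_ : (fun _ => _) = (fun x => (\1_[set x | B (- T x)%R] x)%:E)).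
  by rewrite integral_indic// setIT.
by apply/funext => x; rewrite /g !indicE; congr (_%:R%:E).
Qed.

(** Boxes are the sup-norm balls; their measure is explicit, and it pins down
the constants left open by [integral_rV_additive]. *)
Lemma rV_box_uncons n (r : R) :
  rV_box n.+1 r = @rV_uncons R n @^-1` (`[- r, r]%classic `*` rV_box n r)%R.
Proof.
apply/seteqP; split=> x /=.
  move=> bx; split=> [|i]; first by rewrite /= in_itv/= -ler_norml.
  by rewrite mxE; exact: bx.
move=> [/= h0 h1] i; case: (@splitP 1 n i) => j ij.
  rewrite (_ : i = ord0); first by move: h0; rewrite in_itv/= -ler_norml.
  by apply/val_inj; rewrite /= ij ord1.
have := h1 j; rewrite mxE; congr (`|x _ _| <= _)%R.
exact/val_inj.
Qed.

Lemma measurable_rV_box n (r : R) : measurable (rV_box n r).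
Proof.
elim: n => [|n IH].
  rewrite (_ : rV_box _ _ = setT); first exact: measurableT.
  by apply/seteqP; split=> // x _ [].
rewrite rV_box_uncons -[X in measurable X]setTI.
by apply: measurable_rV_uncons => //; apply: measurableX => //; exact: measurable_itv.
Qed.

Lemma lebesgue_rV_box n (r : R) : (0 <= r)%R ->
  lebesgue_rV n (rV_box n r) = ((2 * r) ^+ n)%:E.
Proof.
move=> r0; elim: n => [|n IH].
  by rewrite /= diracE mem_set ?expr0// => -[].
rewrite rV_box_uncons /= /lebesgue_rV_step /pushforward -comp_preimage.
rewrite (_ : _ \o _ = id) ?preimage_id; last exact/funext/rV_consK.
rewrite product_measure1E//; last exact: measurable_rV_box.
have E : lebesgue_measure `[(- r)%R, r]%classic = (2 * r)%:E.
  rewrite lebesgue_measure_itv/= lte_fin.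
  case: ifPn => [_|]; first by rewrite -EFinB; congr (_%:E); ring.
  by rewrite -leNgt => h; congr (_%:E); lra.
rewrite IH exprS EFinM; congr (_ * _); exact: E.
Qed.

End rV_integral.
Arguments rV_box {R} n r _.

(** * Euclidean norm, balls and cones *)

Section euclid.
Context {R : realType} {n : nat}.
Implicit Types (x y u v w : 'rV[R]_n) (r : R).

Lemma dotrVC u v : dotrV u v = dotrV v u.
Proof. by apply: eq_bigr => i _; rewrite mulrC. Qed.

Lemma dotrVDl u v w : dotrV (u + v) w = dotrV u w + dotrV v w.
Proof. by rewrite -big_split; apply: eq_bigr => i _; rewrite mxE mulrDl. Qed.

Lemma dotrVZl a u w : dotrV (a *: u) w = a * dotrV u w.
Proof. by rewrite mulr_sumr; apply: eq_bigr => i _; rewrite mxE mulrA. Qed.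

Lemma dotrVNl u w : dotrV (- u) w = - dotrV u w.
Proof. by rewrite -scaleN1r dotrVZl mulN1r. Qed.

Lemma dotrVDr u v w : dotrV w (u + v) = dotrV w u + dotrV w v.
Proof. by rewrite dotrVC dotrVDl !(dotrVC w). Qed.

Lemma dotrVZr a u w : dotrV w (a *: u) = a * dotrV w u.
Proof. by rewrite dotrVC dotrVZl (dotrVC w). Qed.

Lemma dotrVNr u w : dotrV w (- u) = - dotrV w u.
Proof. by rewrite dotrVC dotrVNl (dotrVC w). Qed.

Definition dotrVE := (dotrVDl, dotrVDr, dotrVZl, dotrVZr, dotrVNl, dotrVNr).

Lemma dotrV_ge0 u : 0 <= dotrV u u.
Proof. by apply: sumr_ge0 => i _; rewrite -expr2 sqr_ge0. Qed.

Lemma enorm_ge0 u : 0 <= enorm u.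
Proof. exact: sqrtr_ge0. Qed.

Lemma enorm_sqr u : enorm u ^+ 2 = dotrV u u.
Proof. by rewrite sqr_sqrtr// dotrV_ge0. Qed.

Lemma coord_le_enorm u i : `|u ord0 i| <= enorm u.
Proof.
rewrite -(@ler_pXn2r _ 2)// ?nnegrE ?enorm_ge0// enorm_sqr /dotrV (bigD1 i)//=.
rewrite real_normK ?num_real// expr2 lerDl.
by apply: sumr_ge0 => j _; rewrite -expr2 sqr_ge0.
Qed.

Lemma enorm0_eq0 u : enorm u = 0 -> u = 0.
Proof.
move=> u0; apply/rowP => i; rewrite mxE; apply/eqP.
by rewrite -normr_eq0 eq_le normr_ge0 -u0 coord_le_enorm.
Qed.

Lemma enorm0 : enorm (0 : 'rV[R]_n) = 0.
Proof.
by rewrite /enorm /dotrV big1 ?sqrtr0// => i _; rewrite mxE mul0r.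
Qed.

Lemma enorm_le_box r u : (forall i, `|u ord0 i| <= r) -> enorm u <= n%:R * r.
Proof.
case: n u => [u _|k u ur]; first by rewrite /enorm /dotrV big_ord0 sqrtr0 mul0r.
have r0 : 0 <= r := le_trans (normr_ge0 _) (ur ord0).
rewrite -(@ler_pXn2r _ 2)// ?nnegrE ?sqrtr_ge0 ?mulr_ge0//.
rewrite /enorm sqr_sqrtr; last by apply: sumr_ge0 => i _; rewrite -expr2 sqr_ge0.
apply: le_trans (_ : \sum_(i < k.+1) r ^+ 2 <= _).
  apply: ler_sum => i _; rewrite -expr2 -real_normK ?num_real//.
  by rewrite ler_pXn2r ?nnegrE.
rewrite sumr_const card_ord -[leLHS]mulr_natl exprMn ler_wpM2r ?sqr_ge0//.
by rewrite -natrX ler_nat leq_pmulr.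
Qed.

Lemma enormZ a u : enorm (a *: u) = `|a| * enorm u.
Proof.
rewrite /enorm dotrVZl dotrVZr mulrA -expr2 sqrtrM ?sqr_ge0//.
by rewrite sqrtr_sqr.
Qed.

Lemma enormN u : enorm (- u) = enorm u.
Proof. by rewrite -scaleN1r enormZ normrN1 mul1r. Qed.

Lemma enormB u v : enorm (u - v) = enorm (v - u).
Proof. by rewrite -enormN opprB. Qed.

(** The Cauchy-Schwarz inequality, from the square of [enorm v *: u - enorm u *: v]. *)
Lemma dotrV_le u v : dotrV u v <= enorm u * enorm v.
Proof.
have [u0|u0] := eqVneq (enorm u) 0.
  have -> : u = 0 by exact: enorm0_eq0.
  by rewrite -(scale0r (0 : 'rV[R]_n)) dotrVZl enormZ normr0 !mul0r.
have [v0|v0] := eqVneq (enorm v) 0.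
  have -> : v = 0 by exact: enorm0_eq0.
  by rewrite -(scale0r (0 : 'rV[R]_n)) dotrVZr enormZ normr0 !mul0r mulr0.
have ab0 : 0 < enorm u * enorm v by rewrite mulr_gt0// lt_def ?u0 ?v0 enorm_ge0.
have := dotrV_ge0 (enorm v *: u - enorm u *: v).
rewrite !dotrVE (dotrVC v u) -!enorm_sqr.
set a := enorm u in ab0 *; set b := enorm v in ab0 *; set d := dotrV u v => H.
rewrite -(ler_pM2l ab0); nra.
Qed.

Lemma ler_enormD u v : enorm (u + v) <= enorm u + enorm v.
Proof.
rewrite -(@ler_pXn2r _ 2)// ?nnegrE ?addr_ge0 ?enorm_ge0//.
rewrite enorm_sqr !dotrVE (dotrVC v u) -!enorm_sqr.
have := dotrV_le u v; nra.
Qed.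

(** The length and the direction of a point of the cone are determined by the
point, so the existential quantifiers can be eliminated. *)
Lemma open_coneP x v (kappa : R) (delta : \bar R) y :
  open_cone x v kappa delta y <->
  ((enorm (y - x))%:E < delta)%E /\ cos (kappa / 2) * enorm (y - x) < dotrV (y - x) v.
Proof.
split=> [[rho [w [rho0 rhod w1 cw ->]]]|[zd zv]].
  rewrite addrC addKr enormZ w1 mulr1 gtr0_norm//; split => //.
  by rewrite dotrVZl [ltLHS]mulrC ltr_pM2l.
have z0 : 0 < enorm (y - x).
  rewrite lt_def enorm_ge0 andbT; apply/eqP => z0; move: zv.
  rewrite z0 mulr0 (enorm0_eq0 z0) -(scale0r (0 : 'rV[R]_n)) dotrVZl mul0r.
  by rewrite ltxx.
exists (enorm (y - x)), ((enorm (y - x))^-1 *: (y - x)); split => //.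
- by rewrite enormZ gtr0_norm ?invr_gt0// mulVf ?gt_eqF.
- by rewrite dotrVZl [ltRHS]mulrC ltr_pdivlMr.
- by rewrite scalerA divff ?gt_eqF// scale1r addrC subrK.
Qed.

Lemma measurable_dotrV v : measurable_fun [set: 'rV[R]_n] (dotrV ^~ v).
Proof.
rewrite /dotrV; apply: measurable_sum => i.
by apply: measurable_funM => //; exact: measurable_coord.
Qed.

Lemma measurable_enorm : measurable_fun [set: 'rV[R]_n] (@enorm R n).
Proof.
apply: (measurableT_comp (f := @Num.sqrt R)).
  by apply: continuous_measurable_fun; exact: sqrt_continuous.
rewrite /dotrV; apply: measurable_sum => i.
by apply: measurable_funM => //; exact: measurable_coord.
Qed.

Lemma measurable_enormB x : measurable_fun [set: 'rV[R]_n] (fun y => enorm (y - x)).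
Proof. by apply: (measurableT_comp measurable_enorm); exact: measurable_addrV. Qed.

Lemma measurable_cball x r : measurable (cball x r).
Proof.
have := measurable_enormB x measurableT (measurable_itv `]-oo, r]).
by rewrite setTI; congr measurable; apply/seteqP; split=> y /=; rewrite in_itv.
Qed.

Lemma measurable_open_cone x v (kappa : R) (delta : \bar R) :
  measurable (open_cone x v kappa delta).
Proof.
rewrite (_ : open_cone _ _ _ _ = [set y | ((enorm (y - x))%:E < delta)%E] `&`
   [set y | 0 < dotrV (y - x) v - cos (kappa / 2) * enorm (y - x)]); last first.
  by apply/seteqP; split => y /=; rewrite open_coneP subr_gt0.
apply: measurableI.
  rewrite -[X in measurable X]setTI.
  apply: emeasurable_fun_infty_o => //.
  by apply/measurable_EFinP; exact: measurable_enormB.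
have mf : measurable_fun [set: 'rV[R]_n]
    (fun y => dotrV (y - x) v - cos (kappa / 2) * enorm (y - x)).
  apply: measurable_funB; last first.
    by apply: measurable_funM => //; exact: measurable_enormB.
  apply: (measurableT_comp (measurable_dotrV v)); exact: measurable_addrV.
have := mf measurableT _ (measurable_itv `]0, +oo[).
by rewrite setTI; congr measurable; apply/seteqP; split=> y /=; rewrite in_itv/= andbT.
Qed.

End euclid.

(** * Reflections and dilations *)

Lemma mulIe_pos (R : realType) (x y z : \bar R) :
  z \is a fin_num -> (0 < z)%E -> (x * z = y * z)%E -> x = y.
Proof.
by move=> zfin z0 e; apply/le_anti; rewrite -(lee_pmul2r zfin z0 x) -(lee_pmul2r zfin z0 y) e lexx.
Qed.

Section isometries.
Context {R : realType} {n : nat}.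
Implicit Types (x y u v w : 'rV[R]_n) (r : R).

(** For [w = 0] this is the identity, since the inverse of 0 is 0; the case of
equal axes in [reflection_swap] and pure translations in
[integral_le_isometry] rely on it. *)
Definition reflection w x : 'rV[R]_n := x - (2 * dotrV x w / dotrV w w) *: w.

Lemma reflectionD w : {morph reflection w : x y / x + y}.
Proof.
move=> x y; rewrite /reflection dotrVDl mulrDr mulrDl scalerDl opprD.
by rewrite addrACA.
Qed.

Lemma reflectionZ w a x : reflection w (a *: x) = a *: reflection w x.
Proof.
rewrite /reflection dotrVZl scalerBr scalerA; congr (_ - _ *: _); ring.
Qed.

Lemma reflectionN w x : reflection w (- x) = - reflection w x.
Proof. by rewrite -scaleN1r reflectionZ scaleN1r. Qed.

Lemma dotrV_reflection w x y :
  dotrV (reflection w x) (reflection w y) = dotrV x y.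
Proof.
rewrite /reflection !dotrVE (dotrVC w y).
have [->|w0] := eqVneq (dotrV w w) 0; first by rewrite invr0; ring.
by field.
Qed.

Lemma reflectionK w : involutive (reflection w).
Proof.
move=> x; rewrite {1}/reflection.
have [w0|w0] := eqVneq (dotrV w w) 0.
  by rewrite /reflection w0 invr0 !mulr0 scale0r !subr0.
have -> : dotrV (reflection w x) w = - dotrV x w.
  by rewrite /reflection !dotrVE; field.
by rewrite /reflection mulrN mulNr scaleNr opprK subrK.
Qed.

Lemma enorm_reflection w x : enorm (reflection w x) = enorm x.
Proof. by rewrite /enorm dotrV_reflection. Qed.

Lemma reflection_swap u v : enorm u = 1 -> enorm v = 1 -> reflection (u - v) u = v.
Proof.
move=> u1 v1; rewrite /reflection.
have uu : dotrV u u = 1 by rewrite -enorm_sqr u1 expr1n.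
have vv : dotrV v v = 1 by rewrite -enorm_sqr v1 expr1n.
have [w0|w0] := eqVneq (dotrV (u - v) (u - v)) 0.
  rewrite w0 invr0 mulr0 scale0r subr0; apply/subr0_eq/enorm0_eq0.
  by apply/eqP; rewrite -sqrf_eq0 enorm_sqr w0.
have -> : 2 * dotrV u (u - v) / dotrV (u - v) (u - v) = 1.
  apply: (mulIf w0); rewrite mulfVK// mul1r !dotrVE uu vv (dotrVC v u); ring.
by rewrite scale1r opprB addrC subrK.
Qed.

Lemma measurable_reflection w : measurable_fun [set: 'rV[R]_n] (reflection w).
Proof.
apply/measurable_fun_rVP => i.
rewrite (_ : (fun _ => _) = (fun x : 'rV[R]_n => x ord0 i -
    dotrV x w * (2 / dotrV w w * w ord0 i))); last first.
  by apply/funext => x; rewrite !mxE; congr (_ - _); ring.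
apply: measurable_funB; first exact: measurable_coord.
by apply: measurable_funM => //; exact: measurable_dotrV.
Qed.

Lemma measurable_scalerV a : measurable_fun [set: 'rV[R]_n] (fun x => a *: x).
Proof.
apply/measurable_fun_rVP => i.
rewrite (_ : (fun _ => _) = (fun x : 'rV[R]_n => a * x ord0 i)); last first.
  by apply/funext => x; rewrite !mxE.
by apply: measurable_funM => //; exact: measurable_coord.
Qed.

Local Open Scope ereal_scope.
Let mu := @lebesgue_rV R n.

Lemma lebesgue_unit_cball : 0 < mu (cball 0 1) < +oo.
Proof.
have mC := @measurable_cball R n 0 1.
apply/andP; split; last first.
  have sub : cball 0 1 `<=` rV_box n (1 : R).
    by move=> x; rewrite /cball/= subr0 => x1 i; exact: le_trans (coord_le_enorm _ _) x1.
  apply: (@le_lt_trans _ _ (mu (rV_box n (1 : R)))).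
    by apply: le_measure; rewrite ?inE//; exact: measurable_rV_box.
  by rewrite /mu lebesgue_rV_box// ltry.
have r0 : (0 < (n.+1%:R : R)^-1)%R by rewrite invr_gt0.
apply: (@lt_le_trans _ _ (mu (rV_box n (n.+1%:R^-1 : R)))).
  by rewrite /mu lebesgue_rV_box ?(ltW r0)// lte_fin exprn_gt0// mulr_gt0.
apply: le_measure; rewrite ?inE//; first exact: measurable_rV_box.
move=> x xb; rewrite /cball/= subr0.
apply: le_trans (enorm_le_box xb) _.
by rewrite ler_pdivrMr// mul1r ler_nat.
Qed.

(** The unit ball is stable under the reflection and under [-%R], and its measure
is positive and finite, so the constant of [integral_rV_additive] is 1. *)
Lemma integral_reflection w (f : 'rV[R]_n -> \bar R) :
  measurable_fun setT f -> (forall x, 0 <= f x) ->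
  \int[mu]_x f (reflection w x) = \int[mu]_x f x.
Proof.
move=> mf f0.
have := integral_rV_additive (@reflectionD w) (@reflectionK w)
  (@measurable_reflection w) (@measurable_cball R n 0 1) mf f0.
rewrite (_ : [set x | _] = cball 0 1); last first.
  by apply/seteqP; split=> x /=; rewrite /cball/= !subr0 enormN enorm_reflection.
rewrite -/mu; have /andP[m0 moo] := lebesgue_unit_cball.
have mfin : mu (cball 0 1) \is a fin_num by rewrite ge0_fin_numE// ltW.
by rewrite [RHS]muleC; exact: mulIe_pos.
Qed.

(** The constant is read off on a box, which a dilation maps to a box. *)
Lemma integral_scale (s : R) (f : 'rV[R]_n -> \bar R) : (0 < s)%R ->
  measurable_fun setT f -> (forall x, 0 <= f x) ->
  \int[mu]_x f (s *: x)%R = (s ^- n)%:E * \int[mu]_x f x.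
Proof.
move=> s0 mf f0.
have sK : cancel (fun x : 'rV[R]_n => s^-1 *: x)%R (fun x => s *: x)%R.
  by move=> x; rewrite scalerA divff ?gt_eqF// scale1r.
have := integral_rV_additive (scalerDr s) sK (@measurable_scalerV s)
  (@measurable_rV_box _ _ 1) mf f0.
rewrite (_ : [set x | _] = rV_box n (s^-1)%R); last first.
  apply/seteqP; split=> x /= h i; have := h i;
  by rewrite !mxE normrN normrM gtr0_norm// -ler_pdivlMl ?mulr1.
rewrite !lebesgue_rV_box ?invr_ge0 ?(ltW s0)// mulr1 exprMn EFinM exprVn.
move=> H; apply: (@mulIe_pos _ _ _ ((2 : R) ^+ n)%R%:E) => //.
by rewrite [LHS]H -muleA [LHS]muleC.
Qed.

End isometries.

(** * The cone with the least integral *)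

Section cones.
Context {R : realType} {n : nat}.
Implicit Types (x y u v w p : 'rV[R]_n) (r D kappa : R) (delta : \bar R).

(** The distance to the centre in terms of the position relative to a vertex [p]. *)
Lemma enorm_sqrB x p : enorm x ^+ 2 =
  enorm (x - p) ^+ 2 + 2 * dotrV (x - p) p + enorm p ^+ 2.
Proof.
have {1}-> : x = (x - p) + p by rewrite subrK.
by move: (x - p) => z; rewrite !enorm_sqr !dotrVE (dotrVC p); ring.
Qed.

Local Open Scope ereal_scope.
Let mu := @lebesgue_rV R n.

(** The form in which invariance is used, both for comparing cones and, with
[w = 0], for bounding an integral below by that of a constant on a box. *)
Lemma integral_le_isometry w c (A E : set 'rV[R]_n) (f g : 'rV[R]_n -> \bar R) :
  measurable E -> measurable_fun setT g ->
  (forall x, 0 <= f x) -> (forall x, 0 <= g x) ->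
  (forall x, A x -> E (reflection w x + c)%R /\ f x <= g (reflection w x + c)%R) ->
  \int[mu]_(x in A) f x <= \int[mu]_(x in E) g x.
Proof.
move=> mE mg f0 g0 fg; rewrite [leRHS]integral_mkcond.
have mgE : measurable_fun setT (g \_ E).
  by apply/(measurable_restrictT _ mE); exact: measurable_funTS.
have gE0 x : 0 <= (g \_ E) x by exact: erestrict_ge0.
rewrite -(integral_rV_shift c mgE gE0).
rewrite -(@integral_reflection _ _ w (fun x => (g \_ E) (x + c)%R))//; last first.
  by apply: (measurableT_comp mgE); exact: measurable_addrV.
apply: ge0_integral_le_nonmeas => // x /fg[Ex gx]; split => //.
by rewrite /patch mem_set.
Qed.

Context (g : R -> R) (mg : measurable_fun setT g).
Hypothesis g_ge0 : forall r, (0 <= g r)%R.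
Hypothesis g_noninc : forall r s, (0 <= r)%R -> (r <= s)%R -> (g s <= g r)%R.

Let mge : measurable_fun [set: 'rV[R]_n] (fun x => (g (enorm x))%:E).
Proof.
by apply/measurable_EFinP; apply: (measurableT_comp mg); exact: measurable_enorm.
Qed.

(** Polarization. The cones [Cu] and [Cv] have a common part, and the reflection
exchanging [u] and [v] about the vertex maps [Cu `\` Cv] into [Cv `\` Cu]. A
point of the former has a larger component along [u] than along [v], hence its
image has a smaller component along the vertex [r *: u] and is closer to the
centre. *)
Lemma integral_cone_radial r kappa delta D u v :
  enorm u = 1%R -> enorm v = 1%R -> (0 <= r)%R ->
  \int[mu]_(x in open_cone (r *: u)%R u kappa delta `&` cball 0 D) (g (enorm x))%:E <=
  \int[mu]_(x in open_cone (r *: u)%R v kappa delta `&` cball 0 D) (g (enorm x))%:E.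
Proof.
move=> u1 v1 r0.
set Cu := open_cone _ u _ _; set Cv := open_cone _ v _ _.
have mCu : measurable Cu by exact: measurable_open_cone.
have mCv : measurable Cv by exact: measurable_open_cone.
have mB : measurable (@cball R n 0 D) by exact: measurable_cball.
have split_int (A B : set 'rV[R]_n) : measurable A -> measurable B ->
    \int[mu]_(x in A `&` cball 0 D) (g (enorm x))%:E =
    \int[mu]_(x in (A `&` B) `&` cball 0 D) (g (enorm x))%:E +
    \int[mu]_(x in (A `\` B) `&` cball 0 D) (g (enorm x))%:E.
  move=> mA mB'; rewrite -ge0_integral_setU//.
  - by rewrite -setIUl setUIDK.
  - by apply: measurableI => //; exact: measurableI.
  - by apply: measurableI => //; exact: measurableD.
  - exact: measurable_funTS.
  - by move=> x _; rewrite lee_fin.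
  - rewrite disj_set2E; apply/eqP/seteqP; split=> // x.
    by move=> [[[_ Bx] _] [[_ nBx] _]].
rewrite (split_int Cu Cv)// (split_int Cv Cu)// (setIC Cv Cu).
apply: leeD => //.
pose q := (r *: u)%R.
apply: (@integral_le_isometry (u - v)%R (q - reflection (u - v) q)%R) => //.
- by apply: measurableI => //; exact: measurableD.
- by move=> x; rewrite lee_fin.
- by move=> x; rewrite lee_fin.
move=> x [[/open_coneP[xd xu] nCv] xD].
set y := (reflection (u - v) x + _)%R.
have yq : (y - q = reflection (u - v) (x - q))%R.
  by rewrite /y reflectionD reflectionN addrA addrAC addrK.
have Hu : reflection (u - v) u = v by exact: reflection_swap.
have Hv : reflection (u - v) v = u by have := reflectionK (u - v) u; rewrite Hu.
have yv : dotrV (y - q) v = dotrV (x - q) u.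
  by rewrite yq -(dotrV_reflection (u - v) _ u) Hu.
have yu : dotrV (y - q) u = dotrV (x - q) v.
  by rewrite yq -(dotrV_reflection (u - v) _ v) Hv.
have yn : enorm (y - q) = enorm (x - q) by rewrite yq enorm_reflection.
have xv : (dotrV (x - q) v <= cos (kappa / 2) * enorm (x - q))%R.
  by rewrite leNgt; apply/negP => h; apply: nCv; apply/open_coneP; split.
have yx : (enorm y <= enorm x)%R.
  rewrite -(@ler_pXn2r _ 2)// ?nnegrE ?enorm_ge0//.
  rewrite (enorm_sqrB y q) (enorm_sqrB x q) yn {2 4}/q !dotrVZr yu.
  move: xu; rewrite -/q; nra.
split; last by rewrite lee_fin g_noninc// enorm_ge0.
split; last by move: xD; rewrite /cball/= !subr0; apply: le_trans.
split.
  by apply/open_coneP; rewrite yn yv; split.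
by move=> /open_coneP[_]; rewrite yn yu ltNge xv.
Qed.

(** The isometry takes one cone to the other. It moves each point towards the
centre, because both axes point outwards and the aperture is at most [pi]. *)
Lemma integral_cone_push r s kappa delta D u e :
  enorm u = 1%R -> enorm e = 1%R -> (0 <= r)%R -> (r <= s)%R ->
  (0 <= cos (kappa / 2))%R ->
  \int[mu]_(x in open_cone (s *: e)%R e kappa delta `&` cball 0 D) (g (enorm x))%:E <=
  \int[mu]_(x in open_cone (r *: u)%R u kappa delta `&` cball 0 D) (g (enorm x))%:E.
Proof.
move=> u1 e1 r0 rs c0.
apply: (@integral_le_isometry (e - u)%R ((r - s) *: u)%R) => //.
- by apply: measurableI; [exact: measurable_open_cone|exact: measurable_cball].
- by move=> x; rewrite lee_fin.
- by move=> x; rewrite lee_fin.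
move=> x [/open_coneP[xd xe] xD].
set y := (reflection (e - u) x + _)%R.
have He : reflection (e - u) e = u by exact: reflection_swap.
have yq : (y - r *: u = reflection (e - u) (x - s *: e))%R.
  rewrite /y reflectionD reflectionN reflectionZ He scalerBl -addrA.
  by congr (_ + _)%R; rewrite addrAC subrr add0r.
have yu : dotrV (y - r *: u) u = dotrV (x - s *: e) e.
  by rewrite yq -(dotrV_reflection (e - u) _ e) He.
have yn : enorm (y - r *: u) = enorm (x - s *: e) by rewrite yq enorm_reflection.
have xe0 : (0 <= dotrV (x - s *: e) e)%R.
  by apply: le_trans (ltW xe); rewrite mulr_ge0// enorm_ge0.
have yx : (enorm y <= enorm x)%R.
  rewrite -(@ler_pXn2r _ 2)// ?nnegrE ?enorm_ge0//.
  rewrite (enorm_sqrB y (r *: u)) (enorm_sqrB x (s *: e)) yn !dotrVZr yu.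
  rewrite !enormZ u1 e1 !mulr1 !ger0_norm ?(le_trans r0)//.
  nra.
split; last by rewrite lee_fin g_noninc// enorm_ge0.
split; first by apply/open_coneP; rewrite yn yu; split.
by move: xD; rewrite /cball/= !subr0; apply: le_trans.
Qed.

Lemma integral_cone_min s kappa delta D e p v :
  enorm v = 1%R -> enorm e = 1%R -> (enorm p <= s)%R ->
  (0 <= cos (kappa / 2))%R ->
  \int[mu]_(x in open_cone (s *: e)%R e kappa delta `&` cball 0 D) (g (enorm x))%:E <=
  \int[mu]_(x in open_cone p v kappa delta `&` cball 0 D) (g (enorm x))%:E.
Proof.
move=> v1 e1 ps c0.
have [u u1 pu] : exists2 u, enorm u = 1%R & p = (enorm p *: u)%R.
  have [p0|p0] := eqVneq (enorm p) 0%R.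
    by exists v => //; rewrite p0 scale0r; exact: enorm0_eq0.
  exists ((enorm p)^-1 *: p)%R; last by rewrite scalerA divff// scale1r.
  by rewrite enormZ ger0_norm ?invr_ge0 ?enorm_ge0// mulVf.
rewrite [X in open_cone X v]pu.
apply: le_trans (integral_cone_radial _ _ _ u1 v1 (enorm_ge0 p)).
exact: integral_cone_push (enorm_ge0 p) ps c0.
Qed.

End cones.

(** * The two kernels *)

Section kernels.
Context {R : realType} (m : nat).
Implicit Types (h r s t : R).

Definition riesz_kernel t : R := t `^ (-1 - m%:R).

Definition angle_kernel h t : R := (t ^+ 2 + h ^+ 2) `^ (- (m%:R + 1) / 2).

Lemma riesz_kernelE t : 0 <= t -> riesz_kernel t = t ^- m.+1.
Proof. by move=> t0; rewrite -powR_invn// -natr1 opprD addrC. Qed.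

Lemma riesz_kernel_ge0 t : 0 <= riesz_kernel t.
Proof. exact: powR_ge0. Qed.

Lemma le_riesz_kernel s t : 0 < s -> s <= t -> riesz_kernel t <= riesz_kernel s.
Proof.
move=> s0 st; have t0 := lt_le_trans s0 st.
rewrite !riesz_kernelE ?(ltW s0) ?(ltW t0)// lef_pV2 ?posrE ?exprn_gt0//.
by rewrite ler_pXn2r ?nnegrE ?(ltW s0) ?(ltW t0).
Qed.

Lemma riesz_kernelM s t : 0 <= s -> 0 <= t ->
  riesz_kernel (s * t) = s ^- m.+1 * riesz_kernel t.
Proof. by move=> s0 t0; rewrite -riesz_kernelE// /riesz_kernel powRM. Qed.

Lemma angle_kernel_ge0 h t : 0 <= angle_kernel h t.
Proof. exact: powR_ge0. Qed.

Let powRN_le q s t : 0 <= q -> 0 < s -> s <= t -> t `^ (- q) <= s `^ (- q).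
Proof.
move=> q0 s0 st; have t0 := lt_le_trans s0 st.
rewrite !powRN lef_pV2 ?posrE ?powR_gt0//.
by rewrite ge0_ler_powR// nnegrE ltW.
Qed.

Let q_ge0 : 0 <= (m%:R + 1) / 2 :> R.
Proof. by rewrite divr_ge0// addr_ge0. Qed.

Lemma le_angle_kernel h s t : 0 < h -> 0 <= s -> s <= t ->
  angle_kernel h t <= angle_kernel h s.
Proof.
move=> h0 s0 st; rewrite /angle_kernel mulNr powRN_le//.
  by rewrite ltr_wpDl ?sqr_ge0// exprn_gt0.
by rewrite lerD2r ler_pXn2r ?nnegrE// (le_trans s0).
Qed.

Lemma riesz_kernel_sqr t : 0 <= t -> (t ^+ 2) `^ (- ((m%:R + 1) / 2)) = riesz_kernel t.
Proof.
move=> t0; rewrite -powR_mulrn// -powRrM; congr (_ `^ _).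
by field.
Qed.

Lemma angle_kernel_le_riesz h t : 0 < t -> angle_kernel h t <= riesz_kernel t.
Proof.
move=> t0; rewrite /angle_kernel mulNr -riesz_kernel_sqr ?(ltW t0)//.
by rewrite powRN_le ?exprn_gt0// lerDl sqr_ge0.
Qed.

(** For [t >= r], [t^2 + h^2 <= (1 + (h / r)^2) * t^2]. *)
Lemma angle_kernel_ge_riesz h r t : 0 < r -> r <= t ->
  ((1 + (h / r) ^+ 2) ^+ m.+1)^-1 * riesz_kernel t <= angle_kernel h t.
Proof.
move=> r0 rt; have t0 := lt_le_trans r0 rt.
set c := 1 + _; have c1 : 1 <= c by rewrite lerDl sqr_ge0.
have c0 : 0 < c := lt_le_trans ltr01 c1.
apply: (@le_trans _ _ ((c * t ^+ 2) `^ (- ((m%:R + 1) / 2)))).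
  rewrite powRM ?sqr_ge0 ?(ltW c0)// riesz_kernel_sqr ?(ltW t0)//.
  apply: ler_wpM2r; first exact: riesz_kernel_ge0.
  rewrite powRN lef_pV2 ?posrE ?exprn_gt0 ?powR_gt0//.
  rewrite -powR_mulrn ?(ltW c0)// ler_powR// -(@natr1 _ m).
  have := ler0n R m; lra.
rewrite /angle_kernel mulNr powRN_le//.
  by rewrite ltr_pwDl ?exprn_gt0// sqr_ge0.
rewrite mulrDl mul1r lerD2l expr_div_n mulrAC ler_pdivlMr ?exprn_gt0//.
rewrite ler_wpM2l ?sqr_ge0//.
by rewrite ler_pXn2r ?nnegrE// ltW.
Qed.

Lemma measurable_riesz_kernel : measurable_fun [set: R] riesz_kernel.
Proof. exact: measurable_powR. Qed.

Lemma measurable_angle_kernel h : measurable_fun [set: R] (angle_kernel h).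
Proof.
apply: (measurableT_comp (measurable_powR _)).
exact: measurable_funD.
Qed.

End kernels.

(** A quantitative continuity at [t = 0], with a bound valid on a whole interval. *)
Lemma exists_mul_exprn_lt (R : realType) k (M c : R) : 0 <= M -> M < c ->
  exists2 s : R, 0 < s & forall t, 0 <= t -> t <= s -> M * (1 + t) ^+ k < c.
Proof.
elim: k M => [|k IH] M M0 Mc.
  by exists 1 => // t _ _; rewrite mulr1.
(* [M * (1 + s1) < c], and the remaining factors are left to induction. *)
pose s1 := (c - M) / (2 * (M + 1)).
have M1 : 0 < 2 * (M + 1) by lra.
have s10 : 0 < s1 by rewrite divr_gt0// subr_gt0.
have Mc1 : M * (1 + s1) < c.
  have : s1 * (2 * (M + 1)) = c - M by rewrite divfK ?gt_eqF.
  nra.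
have [|s2 s20 Hs2] := IH _ _ Mc1; first by rewrite mulr_ge0// addr_ge0// ltW.
exists (Num.min s1 s2); first by rewrite lt_min s10.
move=> t t0; rewrite le_min => /andP[ts1 ts2].
rewrite exprS mulrA; apply: le_lt_trans (Hs2 t t0 ts2).
by rewrite ler_wpM2r ?exprn_ge0 ?addr_ge0// ler_wpM2l// lerD2l.
Qed.

(** * The integral of the Riesz kernel over a radial cone *)

Section cone_riesz.
Context {R : realType} {m : nat}.
Context (e : 'rV[R]_m) (kappa : R) (delta : \bar R) (D : R).
Hypothesis e1 : enorm e = 1.
Implicit Types (r h : R) (x p v : 'rV[R]_m).
Local Open Scope ereal_scope.
Let mu := @lebesgue_rV R m.

Lemma measurable_radial (g : R -> R) : measurable_fun setT g ->
  measurable_fun [set: 'rV[R]_m] (fun x => (g (enorm x))%:E).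
Proof.
by move=> mg; apply/measurable_EFinP; apply: (measurableT_comp mg); exact: measurable_enorm.
Qed.

Let mk := measurable_radial (@measurable_riesz_kernel R m).

Lemma integral_lower_bound (a : 'rV[R]_m) (eta c : R) (A : set 'rV[R]_m) f :
  measurable A -> measurable_fun [set: 'rV[R]_m] f -> (forall x, 0 <= f x) ->
  (0 <= c)%R -> (0 <= eta)%R ->
  (forall x, (enorm x <= m%:R * eta)%R -> A (x + a)%R /\ c%:E <= f (x + a)%R) ->
  (c * (2 * eta) ^+ m)%:E <= \int[mu]_(x in A) f x.
Proof.
move=> mA mf f0 c0 eta0 Af.
have -> : (c * (2 * eta) ^+ m)%:E = \int[mu]_(x in rV_box m eta) (cst c%:E x).
  rewrite integral_cst; last exact: measurable_rV_box.
  by rewrite EFinM; congr (_ * _); apply/esym/lebesgue_rV_box.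
apply: (@integral_le_isometry _ _ 0%R a) => // x xb.
have -> : (reflection 0 x + a = x + a)%R.
  by rewrite /reflection scaler0 subr0.
exact/Af/enorm_le_box.
Qed.

Definition cone_riesz r : \bar R :=
  \int[mu]_(x in open_cone (r *: e)%R e kappa delta `&` cball 0 D)
     (riesz_kernel m (enorm x))%:E.

Let mcone p v : measurable (open_cone p v kappa delta `&` cball 0 D).
Proof.
by apply: measurableI; [exact: measurable_open_cone|exact: measurable_cball].
Qed.

(** The dilation by [b] maps the truncated cone at distance [r] into the one at
distance [b * r], and the kernel is homogeneous of degree [-1-m], one less
than [-m]. *)
Lemma cone_riesz_scale b r : (0 < b)%R -> (b <= 1)%R ->
  cone_riesz r <= b%:E * cone_riesz (b * r).
Proof.
move=> b0 b1; rewrite /cone_riesz.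
set C := _ `&` _; set E := _ `&` _.
pose g x := ((fun x => (riesz_kernel m (enorm x))%:E) \_ E) x.
have mg : measurable_fun setT g.
  by apply/(measurable_restrictT _ (mcone _ _)); exact: measurable_funTS.
have g0 x : 0 <= g x by apply: erestrict_ge0 => y _; rewrite lee_fin riesz_kernel_ge0.
have mgb : measurable_fun [set: 'rV[R]_m] (fun x => g (b *: x)%R).
  by apply: (measurableT_comp mg); exact: measurable_scalerV.
have -> : b%:E * \int[mu]_(x in E) (riesz_kernel m (enorm x))%:E =
    \int[mu]_x ((b ^+ m.+1)%:E * g (b *: x)%R).
  rewrite ge0_integralZl//; last by rewrite lee_fin exprn_ge0// ltW.
  rewrite [in RHS](integral_scale b0 mg g0) muleA -EFinM exprSr mulrAC divff ?mul1r.
    by rewrite [in LHS]integral_mkcond.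
  by rewrite expf_neq0// gt_eqF.
apply: ge0_integral_le_nonmeas => [x _|x _|x [/open_coneP[xd xe] xD]].
- by rewrite lee_fin riesz_kernel_ge0.
- by rewrite mule_ge0// lee_fin exprn_ge0// ltW.
have bE : (b *: x - (b * r) *: e = b *: (x - r *: e))%R by rewrite scalerBr scalerA.
split => //; rewrite /g /patch mem_set; last first.
  split.
    apply/open_coneP; rewrite bE enormZ gtr0_norm// dotrVZl; split.
      by apply: le_lt_trans xd; rewrite lee_fin ler_piMl// enorm_ge0.
    by rewrite mulrCA ltr_pM2l.
  move: xD; rewrite /cball/= !subr0 enormZ gtr0_norm//; apply: le_trans.
  by rewrite ler_piMl// enorm_ge0.
rewrite enormZ gtr0_norm// riesz_kernelM ?enorm_ge0 ?(ltW b0)// -EFinM mulrA.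
by rewrite divff ?mul1r// expf_neq0// gt_eqF.
Qed.

Hypotheses (c_ge0 : (0 <= cos (kappa / 2))%R) (c_lt1 : (cos (kappa / 2) < 1)%R).
Hypotheses (delta0 : 0 < delta) (D0 : (0 < D)%R).

(** The truncated cone contains a ball centred on its axis. *)
Lemma cone_riesz_gt0 : exists r c : R, [/\ (0 < r)%R, (0 < c)%R & c%:E <= cone_riesz r].
Proof.
have [t t0 [td tD]] : exists2 t : R, (0 < t)%R & (2 * t)%:E < delta /\ (3 * t <= D)%R.
  have [d d0 dd] : exists2 d : R, (0 < d)%R & d%:E <= delta.
    move: delta0; case: (delta) => [d| |] // d0; first by exists d.
    by exists 1%R => //; exact: leey.
  exists (Num.min (d / 3) (D / 3))%R; first by rewrite lt_min !divr_gt0.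
  set t := Num.min _ _.
  have t1 : (t <= d / 3)%R by rewrite ge_min lexx.
  have t2 : (t <= D / 3)%R by rewrite ge_min lexx orbT.
  split; last by lra.
  by apply: lt_le_trans dd; rewrite lte_fin; lra.
have cge0 := c_ge0; have clt1 := c_lt1; set c := cos _ in cge0 clt1.
(* For [|x| <= eps], [c * |x + t e| <= c * (eps + t) < t - eps <= (x + t e).e]. *)
pose eps := (t * (1 - c) / 4)%R.
have eps0 : (0 < eps)%R by rewrite divr_gt0// mulr_gt0// subr_gt0.
have epst : (4 * eps <= t)%R by rewrite /eps; nra.
pose eta := (eps / m.+1%:R)%R.
have eta0 : (0 < eta)%R by rewrite divr_gt0.
have etaE : (m%:R * eta <= eps)%R.
  rewrite /eta mulrCA ler_piMr ?(ltW eps0)// ler_pdivrMr// mul1r ler_nat.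
  exact: leqnSn.
exists t, (riesz_kernel m D * (2 * eta) ^+ m)%R; split => //.
  have k0 : (0 < riesz_kernel m D)%R by exact: powR_gt0.
  by rewrite mulr_gt0// exprn_gt0// mulr_gt0.
apply: (@integral_lower_bound ((2 * t) *: e)%R) => //.
- by move=> x; rewrite lee_fin riesz_kernel_ge0.
- exact: riesz_kernel_ge0.
- exact: ltW.
move=> x /le_trans/(_ etaE) xeps.
have xE : (x + (2 * t) *: e - t *: e = x + t *: e)%R.
  by rewrite -addrA -scalerBl; congr (_ + _ *: _)%R; ring.
have n1 : (enorm (x + t *: e) <= eps + t)%R.
  apply: le_trans (ler_enormD _ _) _.
  by rewrite enormZ e1 mulr1 gtr0_norm// lerD2r.
have xe : (- eps <= dotrV x e)%R.
  have := dotrV_le (- x) e; rewrite dotrVNl e1 mulr1 enormN; lra.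
have ee : dotrV e e = 1%R by rewrite -enorm_sqr e1 expr1n.
have n2 : (enorm (x + (2 * t) *: e) <= D)%R.
  apply: le_trans (ler_enormD _ _) _.
  by rewrite enormZ e1 mulr1 gtr0_norm ?mulr_gt0//; lra.
have n3 : (0 < enorm (x + (2 * t) *: e))%R.
  have := dotrV_le (x + (2 * t) *: e) e; rewrite e1 mulr1 !dotrVE ee; lra.
split; last by rewrite lee_fin le_riesz_kernel.
split; last by rewrite /cball/= subr0.
apply/open_coneP; rewrite xE; split.
  by apply: le_lt_trans td; rewrite lee_fin; lra.
rewrite -/c !dotrVE ee mulr1.
have : (c * enorm (x + t *: e) <= c * (eps + t))%R by rewrite ler_wpM2l.
have : (4 * eps = t * (1 - c))%R by rewrite /eps; field.
nra.
Qed.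

(** Dilate a radius at which [cone_riesz] is positive towards 0. *)
Lemma cone_riesz_unbounded (M : R) : (0 <= M)%R ->
  exists2 r : R, (0 < r)%R & M%:E < cone_riesz r.
Proof.
move=> M0; have [r [c [r0 c0 cr]]] := cone_riesz_gt0.
(* [b * M < c] and [b <= 1]. *)
pose b := (c / (c + M + 1))%R.
have cM : (0 < c + M + 1)%R by lra.
have b0 : (0 < b)%R by rewrite divr_gt0.
have b1 : (b <= 1)%R by rewrite ler_pdivrMr//; lra.
exists (b * r)%R; first by rewrite mulr_gt0.
rewrite ltNge; apply/negP => H.
have := le_trans cr (cone_riesz_scale r b0 b1).
apply/negP; rewrite -ltNge.
apply: le_lt_trans (_ : b%:E * M%:E < _).
  by rewrite lee_wpmul2l// lee_fin ltW.
rewrite -EFinM lte_fin /b mulrAC ltr_pdivrMr// ltr_pM2l//; lra.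
Qed.

(** The threshold on [h] is independent of the vertex and the axis, since
[integral_cone_min] reduces all the cones to a single one. *)
Lemma cone_angle_kernel_gt (M r : R) : (0 < r)%R -> (0 <= M)%R -> M%:E < cone_riesz r ->
  exists2 h0 : R, (0 < h0)%R & forall h, (0 < h)%R -> (h < h0)%R ->
    forall p v, enorm v = 1%R -> (enorm p <= r)%R ->
    M%:E < \int[mu]_(x in open_cone p v kappa delta `&` cball 0 D)
              (angle_kernel m h (enorm x))%:E.
Proof.
move=> r0 M0 MF.
have [c Mc cF] : exists2 c : R, (M < c)%R & c%:E <= cone_riesz r.
  move: MF; case: cone_riesz => [c| |]// Mc; first by exists c.
  by exists (M + 1)%R; rewrite ?ltrDl// leey.
have [s s0 Hs] := exists_mul_exprn_lt m.+1 M0 Mc.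
exists (r * Num.min s 1)%R; first by rewrite mulr_gt0// lt_min s0/=.
move=> h h0 hh p v v1 pr.
apply: lt_le_trans (integral_cone_min (measurable_angle_kernel m h)
  (@angle_kernel_ge0 _ m h) _ _ _ v1 e1 pr c_ge0); last first.
  by move=> a b a0 ab; exact: le_angle_kernel.
set a := ((1 + (h / r) ^+ 2) ^+ m.+1)%R.
have a0 : (0 < a)%R by rewrite exprn_gt0// ltr_pwDl// sqr_ge0.
have hr : ((h / r) ^+ 2 <= s)%R.
  have x0 : (0 <= h / r)%R by rewrite divr_ge0 ?ltW.
  have : (h / r < Num.min s 1)%R by rewrite ltr_pdivrMr// mulrC.
  rewrite lt_min => /andP[xs x1]; apply: le_trans (ltW xs).
  by rewrite expr2 ler_piMl// ltW.
apply: (@lt_le_trans _ _ ((a^-1)%:E * cone_riesz r)).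
  apply: (@lt_le_trans _ _ ((a^-1)%:E * c%:E)).
    by rewrite -EFinM lte_fin mulrC ltr_pdivlMr// Hs// sqr_ge0.
  by rewrite lee_wpmul2l// lee_fin invr_ge0 ltW.
have ainv0 : 0 <= (a^-1)%:E by rewrite lee_fin invr_ge0 ltW.
have k_ge0 (x : 'rV[R]_m) : 0 <= (riesz_kernel m (enorm x))%:E.
  by rewrite lee_fin riesz_kernel_ge0.
have mkC := measurable_funTS (D := open_cone (r *: e)%R e kappa delta `&` cball 0 D) mk.
rewrite /cone_riesz -(ge0_integralZl mu (mcone _ _) mkC (fun x _ => k_ge0 x) ainv0).
apply: ge0_integral_le_nonmeas => [x _|x _|x Cx].
- by rewrite -EFinM lee_fin mulr_ge0 ?riesz_kernel_ge0// invr_ge0 ltW.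
- by rewrite lee_fin angle_kernel_ge0.
split=> //; rewrite -EFinM lee_fin; apply: angle_kernel_ge_riesz => //.
have [/open_coneP[_ xe] _] := Cx.
have ee : dotrV e e = 1%R by rewrite -enorm_sqr e1 expr1n.
have := dotrV_le x e; rewrite e1 mulr1.
have : (0 <= cos (kappa / 2) * enorm (x - r *: e))%R by rewrite mulr_ge0// enorm_ge0.
move: xe; rewrite !dotrVE ee; lra.
Qed.

End cone_riesz.

(** * Bodies, and the comparison of the two solid angles *)

Lemma cos_half_bounds (R : realType) (kappa : R) :
  0 < kappa -> kappa <= pi -> 0 <= cos (kappa / 2) /\ cos (kappa / 2) < 1.
Proof.
move=> k0 kpi; have pi0 := pi_gt0 R; split.
  by apply: cos_ge0_pihalf; apply/andP; split; lra.
have h0 : 0 < kappa / 2 by rewrite divr_gt0.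
have h1 : kappa / 2 <= pi by lra.
by rewrite -[ltRHS]cos0 ltr_cos// in_itv/= ?lexx ?pi_ge0 ?h1 ?ltW.
Qed.

Section bodies.
Context {R : realType} {m : nat}.
Implicit Types (x y z : 'rV[R]_m) (X Y : set 'rV[R]_m).

Lemma body_sub_box X : body X -> exists2 M : R, 0 <= M & X `<=` rV_box m M.
Proof.
move=> [U [_ [M0 [_ HM]] ->]].
pose M := Num.max (M0 + 1) 1.
have M1 : 1 <= M by rewrite le_max lexx orbT.
have M0M : M0 < M by rewrite lt_max ltrDl ltr01.
exists (M + 2); first by lra.
move=> x /(_ _ (nbhsx_ballx x 1 ltr01))[y [Uy xy]] i.
have yM : `|y ord0 i| < M + 1.
  have : ball (0 : 'rV[R]_m) (M + 1) y.
    rewrite mx_norm_ball /ball_/= sub0r normrN.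
    by apply: le_lt_trans (HM _ M0M _ Uy) _; rewrite ltrDl.
  by move=> [_ /(_ ord0 i)]; rewrite /ball/= mxE sub0r normrN.
have := xy.2 ord0 i; rewrite /ball/= => xyi.
have := ler_normD (x ord0 i - y ord0 i) (y ord0 i); rewrite subrK.
lra.
Qed.

Lemma body_closed X : body X -> closed X.
Proof. by move=> [U [_ _ ->]]; exact: closed_closure. Qed.

Lemma euclid_dist_le x A z : A z -> euclid_dist x A <= enorm (x - z).
Proof.
move=> Az; apply: ge_inf; last by exists z.
by exists 0 => _ [w _ <-]; exact: enorm_ge0.
Qed.

Lemma euclid_dist_lt x A r : A !=set0 -> euclid_dist x A < r ->
  exists2 z, A z & enorm (x - z) < r.
Proof.
move=> [a Aa] /inf_lt[|_ [z Az <-] zr]; first by exists (enorm (x - a)), a.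
by exists z.
Qed.

(** The open ball lies in [X] by definition of the distance; a point of the sphere
is a limit of points of the radius ending there. *)
Lemma cball_sub_of_dist X x r : closed X -> 0 < r -> r <= euclid_dist x (~` X) ->
  cball x r `<=` X.
Proof.
move=> cX r0 rd z; rewrite /cball/= => zr.
pose f (t : R) : 'rV[R]_m := z + t *: (x - z).
have f0 : f t @[t --> 0^'+] --> z.
  apply: cvg_at_right_filter; rewrite -[X in _ --> X]addr0 -(scale0r (x - z)).
  by apply: cvgD; [exact: cvg_cst|exact: scalel_continuous].
apply: (closed_cvg X cX _ _ f0).
near=> t.
have t0 : 0 < t by [].
have t1 : t < 1 by near: t; exact: nbhs_right_lt.
apply: contrapT => nX.
have := le_trans rd (euclid_dist_le x nX).
have -> : x - f t = (1 - t) *: (x - z).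
  by rewrite /f scalerBl scale1r opprD addrA.
rewrite enormZ ger0_norm ?subr_ge0 ?(ltW t1)// enormB.
have := enorm_ge0 (z - x); nra.
Unshelve. all: by end_near. Qed.

Lemma enormB_le_diam Y M y z : Y `<=` rV_box m M -> Y y -> Y z ->
  enorm (y - z) <= euclid_diam Y.
Proof.
move=> YM Yy Yz; apply: sup_ubound; last by exists y => //; exists z.
exists (m%:R * (M + M)) => _ [a Ya [b Yb <-]].
apply: enorm_le_box => i; rewrite !mxE; apply: le_trans (ler_normB _ _) _.
by apply: lerD; apply: YM.
Qed.

Lemma box_compl_nonempty Y M : (0 < m)%N -> Y `<=` rV_box m M -> ~` Y !=set0.
Proof.
move=> m0 YM; exists (const_mx (`|M| + 1)) => /YM/(_ (Ordinal m0)).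
rewrite mxE ger0_norm ?addr_ge0// => h.
have := ler_norm M; lra.
Qed.

Lemma enorm_basis (k : nat) : (k < m)%N -> enorm (basis_rV m k : 'rV[R]_m) = 1.
Proof.
move=> km; rewrite /enorm /dotrV (bigD1 (Ordinal km))//= big1 => [|i ik].
  by rewrite !mxE eqxx mulr1 addr0 sqrtr1.
rewrite !mxE (_ : (i : nat) == k = false) ?mul0r//.
by apply/negbTE; apply: contra ik => /eqP ik; apply/eqP/val_inj.
Qed.

Local Open Scope ereal_scope.
Let mu := @lebesgue_rV R m.

Lemma integral_box_le (A : set 'rV[R]_m) f (M c : R) : (0 <= M)%R -> (0 <= c)%R ->
  (forall x, A x -> 0 <= f x) -> (forall x, A x -> rV_box m M x /\ f x <= c%:E) ->
  \int[mu]_(x in A) f x <= (c * (2 * M) ^+ m)%:E.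
Proof.
move=> M0 c0 f0 fc.
have -> : (c * (2 * M) ^+ m)%:E = \int[mu]_(x in rV_box m M) (cst c%:E x).
  rewrite integral_cst; last exact: measurable_rV_box.
  by rewrite EFinM; congr (_ * _); apply/esym/lebesgue_rV_box.
by apply: ge0_integral_le_nonmeas => // x _; rewrite lee_fin.
Qed.

Lemma cball_sub_box (D : R) : cball 0 D `<=` rV_box m D.
Proof.
by move=> x; rewrite /cball/= subr0 => xD i; exact: le_trans (coord_le_enorm _ _) xD.
Qed.

Let mcball (r : R) : measurable (cball (0 : 'rV[R]_m) r).
Proof. exact: measurable_cball. Qed.

(** Finiteness holds because the kernel is bounded away from the centre, and
positivity because the annulus contains a ball. *)
Lemma riesz_annulus (D R0 : R) : (0 < m)%N -> (0 < R0)%R -> (R0 < D)%R ->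
  exists2 K : R, (0 < K)%R &
    riesz_integral (-1) (cball (0 : 'rV[R]_m) D `\` cball 0 R0) = K%:E.
Proof.
move=> m0 R00 R0D.
have D0 := lt_trans R00 R0D.
set I := riesz_integral _ _.
have Ile : I <= (riesz_kernel m R0 * (2 * D) ^+ m)%:E.
  apply: integral_box_le; [exact: ltW|exact: riesz_kernel_ge0| |].
    by move=> x _; rewrite lee_fin riesz_kernel_ge0.
  move=> x [/cball_sub_box xD]; rewrite /cball/= subr0 => /negP; rewrite -ltNge => xR.
  by split => //; rewrite lee_fin le_riesz_kernel// ltW.
pose e : 'rV[R]_m := basis_rV m 0.
have e1 : enorm e = 1%R by exact: enorm_basis.
(* A ball about the middle of the annulus, of a quarter of its width. *)
pose eps := ((D - R0) / 4)%R.
pose eta := (eps / m.+1%:R)%R.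
have eps0 : (0 < eps)%R by rewrite divr_gt0// subr_gt0.
have eta0 : (0 < eta)%R by rewrite divr_gt0.
have etaE : (m%:R * eta <= eps)%R.
  rewrite /eta mulrCA ler_piMr ?(ltW eps0)// ler_pdivrMr// mul1r ler_nat.
  exact: leqnSn.
have Ige : (riesz_kernel m D * (2 * eta) ^+ m)%:E <= I.
  apply: (@integral_lower_bound _ _ (((R0 + D) / 2) *: e)%R) => //.
  - exact: measurableD.
  - exact: measurable_radial (@measurable_riesz_kernel R m).
  - by move=> x; rewrite lee_fin riesz_kernel_ge0.
  - exact: riesz_kernel_ge0.
  - exact: ltW.
  move=> x /le_trans/(_ etaE) xeps.
  set a := ((R0 + D) / 2)%R.
  have aE : enorm (a *: e) = a by rewrite enormZ e1 mulr1 ger0_norm// /a; lra.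
  have n1 : (enorm (x + a *: e) <= D)%R.
    apply: le_trans (ler_enormD _ _) _; rewrite aE /a; move: xeps; rewrite /eps; lra.
  have n2 : (R0 < enorm (x + a *: e))%R.
    have := ler_enormD (x + a *: e) (- x); rewrite addrAC subrr add0r aE enormN /a.
    move: xeps; rewrite /eps; lra.
  split; last by rewrite lee_fin le_riesz_kernel// (lt_trans R00).
  by split; rewrite /cball/= subr0//; apply/negP; rewrite -ltNge.
have k0 : (0 < riesz_kernel m D)%R by exact: powR_gt0.
have I0 : 0 < I.
  by apply: lt_le_trans Ige; rewrite lte_fin mulr_gt0// exprn_gt0// mulr_gt0.
have Ifin : I \is a fin_num by rewrite ge0_fin_numE ?(ltW I0)// (le_lt_trans Ile)// ltry.
by exists (fine I); rewrite ?fineK// fine_gt0// I0 (le_lt_trans Ile)// ltry.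
Qed.

(** At the angle 0 the cones in the definition of the excess are radial. *)
Lemma axis_cone0 (kappa r : R) (delta : \bar R) :
  @axis_cone R m kappa delta 0 r = open_cone (r *: basis_rV m 0)%R (basis_rV m 0) kappa delta.
Proof. by rewrite /axis_cone cos0 sin0 scale0r scale1r addr0. Qed.

(** At [Rtilde] the excess at the angle 0 is nonnegative, and dilating by
[(1 + b) / 2] makes it positive. If there is no zero, any radius with
[cone_riesz] above [K] will do. *)
Lemma Rtilde_lt_cone_riesz (kappa b : R) (delta : \bar R) (D R0 K : R) :
  (0 < m)%N -> (0 < kappa)%R -> (kappa <= pi)%R -> 0 < delta -> (0 < D)%R ->
  (0 < K)%R -> riesz_integral (-1) (cball (0 : 'rV[R]_m) D `\` cball 0 R0) = K%:E ->
  (0 < b)%R -> (b < 1)%R ->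
  exists r : R, [/\ (0 < r)%R, (b * Rtilde m (-1) kappa delta D R0 < r)%R &
    K%:E < cone_riesz (basis_rV m 0) kappa delta D r].
Proof.
move=> m0 k0 kpi d0 D0 K0 KE b0 b1.
have e1 : enorm (basis_rV m 0 : 'rV[R]_m) = 1%R by exact: enorm_basis.
have [cge0 clt1] := cos_half_bounds k0 kpi.
rewrite /Rtilde; case: xgetP => [r rE [r0 Er]|_]; last first.
  have [r r0 Hr] := cone_riesz_unbounded e1 cge0 clt1 d0 D0 (ltW K0).
  by exists r; split => //; rewrite mulr0.
(* Strictly between [b] and 1, to leave room for the strict inequality. *)
pose b' := ((1 + b) / 2)%R.
exists (b' * r)%R; rewrite /b'; split.
- by rewrite mulr_gt0// divr_gt0// addr_gt0.
- by rewrite ltr_pM2r//; lra.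
have KF : K%:E <= cone_riesz (basis_rV m 0) kappa delta D r.
  rewrite -sube_ge0// -Er; apply: ereal_inf_lbound.
  exists 0%R; last by rewrite axis_cone0 KE.
  by rewrite /= in_itv/= lexx divr_ge0// subr_ge0.
have b'0 : (0 < b')%R by rewrite /b'; lra.
have b'1 : (b' < 1)%R by rewrite /b'; lra.
have := le_trans KF (@cone_riesz_scale _ _ _ _ _ _ b' r b'0 (ltW b'1)).
rewrite -lee_pdivrMl// => /(lt_le_trans _); apply.
by rewrite -EFinM lte_fin ltr_pdivlMl// gtr_pMl.
Qed.

(** With [B] the ball of radius [D] and [C] the cone seen from [y], [Y] sits in
[B `\` C], up to points farther than [D] that contribute at most
[c0 * (2 * M) ^+ m]. Writing the integral over [B] once as [C] plus the rest and
once as the ball of radius [R0] plus the annulus gives the claim. *)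
Lemma angle_integral_lt (Y : set 'rV[R]_m) (h D R0 M c0 K kappa : R) (delta : \bar R) y z v :
  (0 < h)%R -> (0 < R0)%R -> (R0 < D)%R -> (0 <= M)%R -> (0 <= c0)%R ->
  Y `<=` rV_box m M -> open_cone z v kappa delta `<=` ~` Y ->
  (forall xi, Y xi -> (D < enorm (xi - y))%R -> (angle_kernel m h (enorm (xi - y)) <= c0)%R) ->
  riesz_integral (-1) (cball (0 : 'rV[R]_m) D `\` cball 0 R0) = K%:E ->
  (K + c0 * (2 * M) ^+ m)%:E <
    \int[mu]_(x in open_cone (z - y)%R v kappa delta `&` cball 0 D)
       (angle_kernel m h (enorm x))%:E ->
  \int[mu]_(xi in Y) (angle_kernel m h (enorm (y - xi)))%:E <
  \int[mu]_(x in cball 0 R0) (angle_kernel m h (enorm x))%:E.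
Proof.
move=> h0 R00 R0D M0 c00 YM CY Yc KE HK.
have D0 := lt_trans R00 R0D.
set k := fun x => (angle_kernel m h (enorm x))%:E in HK *.
set C := open_cone (z - y) v kappa delta in HK *.
pose B := cball (0 : 'rV[R]_m) D.
have mk : measurable_fun [set: 'rV[R]_m] k.
  exact: measurable_radial (measurable_angle_kernel m h).
have k0 x : 0 <= k x by rewrite lee_fin angle_kernel_ge0.
have mC : measurable C by exact: measurable_open_cone.
have mB : measurable B := mcball D.
have IB : \int[mu]_(x in B) k x < +oo.
  apply: le_lt_trans (ltry (angle_kernel m h 0 * (2 * D) ^+ m)).
  apply: integral_box_le => //; [exact: ltW|exact: angle_kernel_ge0|].
  move=> x /cball_sub_box; split => //.
  by rewrite lee_fin le_angle_kernel// enorm_ge0.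
have split_int (E : set 'rV[R]_m) : measurable E ->
    \int[mu]_(x in B) k x = \int[mu]_(x in E `&` B) k x + \int[mu]_(x in B `\` E) k x.
  move=> mE; rewrite -ge0_integral_setU//.
  - by rewrite setIC setUIDK.
  - exact: measurableI.
  - exact: measurableD.
  - exact: measurable_funTS.
  - by rewrite disj_set2E; apply/eqP/seteqP; split=> // x [[Ex _] [_ nEx]].
have sub_fin (E : set 'rV[R]_m) : E `<=` B -> \int[mu]_(x in E) k x \is a fin_num.
  move=> EB; rewrite ge0_fin_numE; last exact: integral_ge0.
  by apply: le_lt_trans IB; apply: ge0_integral_le_nonmeas => // x /EB.
have annulus_le : \int[mu]_(x in B `\` cball 0 R0) k x <= K%:E.
  rewrite -KE; apply: ge0_integral_le_nonmeas => // [x _|x [Bx nx]].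
    by rewrite lee_fin powR_ge0.
  split => //; rewrite lee_fin; apply: angle_kernel_le_riesz.
  by move: nx; rewrite /cball/= subr0 => /negP; rewrite -ltNge; apply: lt_trans.
have Y_le : \int[mu]_(xi in Y) k (y - xi)%R <=
    \int[mu]_(x in B `\` C) k x + (c0 * (2 * M) ^+ m)%:E.
  (* [g1] accounts for the points within [D] of [y], [g2] for the others. *)
  pose g1 := k \_ (B `\` C).
  pose g2 := (cst c0%:E : 'rV[R]_m -> \bar R) \_ (rV_box m M).
  have mBC : measurable (B `\` C) by exact: measurableD.
  have mg1 : measurable_fun setT g1.
    by apply/(measurable_restrictT _ mBC); exact: measurable_funTS.
  have mg2 : measurable_fun setT g2.
    by apply/(measurable_restrictT _ (@measurable_rV_box _ _ _)); exact: measurable_cst.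
  have g10 x : 0 <= g1 x by exact: erestrict_ge0.
  have g20 x : 0 <= g2 x by apply: erestrict_ge0 => w _; rewrite lee_fin.
  have -> : \int[mu]_(x in B `\` C) k x + (c0 * (2 * M) ^+ m)%:E =
      \int[mu]_xi (g1 (xi - y)%R + g2 xi).
    have mg1y : measurable_fun [set: 'rV[R]_m] (fun xi : 'rV[R]_m => g1 (xi - y)%R).
      by apply: (measurableT_comp mg1); exact: measurable_addrV.
    rewrite (ge0_integralD mu measurableT (fun xi _ => g10 _) mg1y (fun xi _ => g20 _) mg2).
    rewrite [X in _ = X + _](integral_rV_shift (- y)%R mg1 g10); congr (_ + _).
      by rewrite [LHS]integral_mkcond.
    rewrite -integral_mkcond integral_cst; last exact: measurable_rV_box.
    by rewrite EFinM; congr (_ * _); apply/esym/lebesgue_rV_box.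
  apply: ge0_integral_le_nonmeas => [x _|x _|xi Yxi]; [exact: k0|exact: adde_ge0|split=> //].
  rewrite /k enormB; have [xiD|xiD] := leP (enorm (xi - y)) D.
    rewrite {1}/g1 /patch mem_set ?leeDl//; split.
      by rewrite /B /cball/= subr0.
    move=> /open_coneP; rewrite opprB addrA subrK => Cxi.
    by apply: (CY xi) Yxi; apply/open_coneP.
  rewrite {1}/g2 /patch mem_set; last exact: YM.
  by apply: le_trans (_ : c0%:E <= _); [rewrite lee_fin Yc|rewrite leeDr].
apply: le_lt_trans Y_le _.
have BC := split_int C mC.
have BR := split_int _ (mcball R0).
have RB : cball 0 R0 `&` B = cball (0 : 'rV[R]_m) R0.
  apply/setIidPl => x; rewrite /B /cball/= => /le_trans; apply; exact: ltW.
rewrite RB BC in BR; move: BR HK annulus_le.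
have : cball (0 : 'rV[R]_m) R0 `<=` B by rewrite -RB; exact: subIsetr.
move=> /sub_fin; move: (sub_fin (B `\` C) (@subDsetl _ _ _)).
move: (sub_fin (C `&` B) (@subIsetr _ _ _)) (sub_fin (B `\` cball 0 R0) (@subDsetl _ _ _)).
case: (\int[mu]_(x in C `&` B) _) => [p| |]// _.
case: (\int[mu]_(x in B `\` cball 0 R0) _) => [q| |]// _.
case: (\int[mu]_(x in B `\` C) _) => [s| |]// _.
case: (\int[mu]_(x in cball 0 R0) _) => [t| |]// _.
rewrite -!EFinD => -[pq]; rewrite !lte_fin lee_fin => HK qK.
lra.
Qed.

End bodies.

Theorem proposition5p3 (R : realType) (m : nat) (X Y : set 'rV[R]_m)
    (kappa : R) (delta : \bar R) (R0 : R) :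
  (2 <= m)%N ->
  body X -> body Y ->
  0 < kappa -> kappa <= pi -> (0 < delta)%E ->
  uniform_interior_cone (~` Y) kappa delta ->
  0 < R0 -> R0 < euclid_diam Y ->
  forall b : R, 0 < b -> b < 1 ->
  exists2 h0 : R, 0 < h0 &
    forall h : R, 0 < h -> h < h0 ->
    forall x y : 'rV[R]_m,
      X x -> R0 <= euclid_dist x (~` X) ->
      euclid_dist y (~` Y) <= b * Rtilde m (-1) kappa delta (euclid_diam Y) R0 ->
      solid_angle Y y h < solid_angle X x h.
Proof.
move=> m2 bX bY k0 kpi d0 [_ coneY] R00 R0D b b0 b1.
have m0 : (0 < m)%N by exact: ltn_trans m2.
set D := euclid_diam Y in R0D *.
have D0 := lt_trans R00 R0D.
have [MX MX0 XM] := body_sub_box bX.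
have [M M0 YM] := body_sub_box bY.
have [K K0 KE] := riesz_annulus m0 R00 R0D.
have [r [r0 rR rK]] := Rtilde_lt_cone_riesz m0 k0 kpi d0 D0 K0 KE b0 b1.
have e1 : enorm (basis_rV m 0 : 'rV[R]_m) = 1 by exact: enorm_basis.
have [cge0 clt1] := cos_half_bounds k0 kpi.
have [h1 h10 H1] := cone_angle_kernel_gt e1 cge0 r0 (ltW K0) rK.
(* For [y] outside [Y], the cone must also outweigh the points of [Y] beyond [D]. *)
pose K2 := K + riesz_kernel m D * (2 * M) ^+ m.
have K20 : 0 <= K2.
  by rewrite addr_ge0 ?(ltW K0)// mulr_ge0 ?riesz_kernel_ge0// exprn_ge0// mulr_ge0.
have [r2 r20 r2K] := cone_riesz_unbounded e1 cge0 clt1 d0 D0 K20.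
have [h2 h20 H2] := cone_angle_kernel_gt e1 cge0 r20 K20 r2K.
exists (Num.min h1 h2); first by rewrite lt_min h10.
move=> h h0; rewrite lt_min => /andP[hh1 hh2] x y Xx xd yd.
have Yint : (\int[lebesgue_rV m]_(xi in Y) (angle_kernel m h (enorm (y - xi)))%:E <
    \int[lebesgue_rV m]_(x in cball 0 R0) (angle_kernel m h (enorm x))%:E)%E.
  have [Yy|nYy] := pselect (Y y).
    have [z nYz yz] := euclid_dist_lt (box_compl_nonempty m0 YM) (le_lt_trans yd rR).
    have [v v1 vC] := coneY z nYz.
    have noY xi : Y xi -> D < enorm (xi - y) -> angle_kernel m h (enorm (xi - y)) <= 0.
      by move=> Yxi; rewrite ltNge => /negP[]; exact: enormB_le_diam YM Yxi Yy.
    have zyr : enorm (z - y) <= r by rewrite enormB ltW.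
    have HK := H1 h h0 hh1 (z - y) v v1 zyr.
    have E0 : K = K + 0 * (2 * M) ^+ m by rewrite mul0r addr0.
    rewrite E0 in HK.
    exact: (angle_integral_lt h0 R00 R0D M0 (lexx 0) YM vC noY KE HK).
  have [v v1 vC] := coneY y nYy.
  have farY xi : Y xi -> D < enorm (xi - y) ->
      angle_kernel m h (enorm (xi - y)) <= riesz_kernel m D.
    move=> _ xiD; apply: le_trans (angle_kernel_le_riesz _ _ (lt_trans D0 xiD)) _.
    by apply: le_riesz_kernel D0 _; exact: ltW.
  have yyr : enorm (y - y) <= r2 by rewrite subrr enorm0 ltW.
  have HK := H2 h h0 hh2 (y - y) v v1 yyr.
  exact: (angle_integral_lt h0 R00 R0D M0 (riesz_kernel_ge0 m D) YM vC farY KE HK).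
(* The closed ball about [x] is measurable and lies between the two domains. *)
have Xint : (\int[lebesgue_rV m]_(x in cball 0 R0) (angle_kernel m h (enorm x))%:E <=
    \int[lebesgue_rV m]_(xi in X) (angle_kernel m h (enorm (x - xi)))%:E)%E.
  apply: (@le_trans _ _ (\int[lebesgue_rV m]_(xi in cball x R0)
      (angle_kernel m h (enorm (x - xi)))%:E)%E); last first.
    apply: ge0_integral_le_nonmeas => [w _|w _|w xw]; rewrite ?lee_fin ?angle_kernel_ge0//.
    by split => //; exact: cball_sub_of_dist (body_closed bX) R00 xd w xw.
  apply: (@integral_le_isometry _ _ 0 x).
  - exact: measurable_cball.
  - apply: (measurableT_comp (f := fun w => (angle_kernel m h (enorm w))%:E)).
      exact: measurable_radial (measurable_angle_kernel m h).
    rewrite (_ : (fun _ => _) = (fun w => -1 *: (w - x))); last first.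
      by apply/funext => w; rewrite scaleN1r opprB.
    apply: (measurableT_comp (measurable_scalerV (-1))).
    exact: measurable_addrV.
  - by move=> w; rewrite lee_fin angle_kernel_ge0.
  - by move=> w; rewrite lee_fin angle_kernel_ge0.
  - move=> w; rewrite /cball/= subr0 => wR.
    have -> : reflection 0 w + x = w + x by rewrite /reflection scaler0 subr0.
    by rewrite addrK opprD addrCA subrr addr0 enormN.
have Xoo : (\int[lebesgue_rV m]_(xi in X) (angle_kernel m h (enorm (x - xi)))%:E < +oo)%E.
  apply: le_lt_trans (ltry (angle_kernel m h 0 * (2 * MX) ^+ m)).
  apply: integral_box_le => //; first exact: angle_kernel_ge0.
    by move=> w _; rewrite lee_fin angle_kernel_ge0.
  move=> w Xw; split; first exact: XM.
  by rewrite lee_fin le_angle_kernel// enorm_ge0.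
have XY := lt_le_trans Yint Xint.
have kernel_ge0 (A : set 'rV[R]_m) w :
    (0 <= \int[lebesgue_rV m]_(xi in A) (angle_kernel m h (enorm (w - xi)))%:E)%E.
  by apply: integral_ge0 => xi _; rewrite lee_fin angle_kernel_ge0.
have Xfin : (\int[lebesgue_rV m]_(xi in X) (angle_kernel m h (enorm (x - xi)))%:E)%E
    \is a fin_num by rewrite (ge0_fin_numE (kernel_ge0 X x)).
have Yfin : (\int[lebesgue_rV m]_(xi in Y) (angle_kernel m h (enorm (y - xi)))%:E)%E
    \is a fin_num by rewrite (ge0_fin_numE (kernel_ge0 Y y)) (lt_trans XY Xoo).
have := fine_lt Yfin Xfin XY.
by rewrite /solid_angle (ltr_pM2l h0).
Qed.
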